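(* (The algebraic c-bi-free central limit theorem.) Let $I,J$ be disjoint index sets and let $\{((a_{n,i})_{i\in I},(a_{n,j})_{j\in J})\}_{n=1}^\infty$ be a sequence of c-bi-free two-faced families in a two-state non-commutative probability space $(\mathcal{A},\varphi,\psi)$ such that (1) $\varphi(a_{n,k})=\psi(a_{n,k})=0$ for all $n\ge1$ and $k\in I\sqcup J$; (2) $\sup_{n\ge1}|\varphi(a_{n,k_1}\cdots a_{n,k_m})|<\infty$ and $\sup_{n\ge1}|\psi(a_{n,k_1}\cdots a_{n,k_m})|<\infty$ for all $m\geq 1$ and $k_1,\dots,k_m\in I\sqcup J$; (3) $\lim_{N\to\infty}\frac1N\sum_{n=1}^N\varphi(a_{n,k}a_{n,p})=C^\varphi_{k,p}$ and $\lim_{N\to\infty}\frac1N\sum_{n=1}^N\psi(a_{n,k}a_{n,p})=C^\psi_{k,p}$ for all $k,p\in I\sqcup J$, where $C^\varphi=(C^\varphi_{k,p})_{k,p\in I\sqcup J}$ and $C^\psi=(C^\psi_{k,p})_{k,p\in I\sqcup J}$ are complex matrices. For $N\in\mathbb{N}$, let $\hat S_N=((S_{N,i})_{i\in I},(S_{N,j})_{j\in J})$ be the two-faced family defined by $S_{N,k}=\frac1{\sqrt N}\sum_{n=1}^Na_{n,k}$, $k\in I\sqcup J$. Then $\hat S_N$ converges in distribution as $N\to\infty$ to a centred c-bi-free Gaussian distribution with covariance matrices $(C^\varphi,C^\psi)$.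
   Context: A two-state non-commutative probability space is a triple $(\mathcal{A},\varphi,\psi)$ with $\mathcal{A}$ a complex unital algebra and $\varphi,\psi$ unital linear functionals. A two-faced family $((a_i)_{i\in I},(a_j)_{j\in J})$ consists of elements of $\mathcal{A}$; those indexed by $I$ are left variables, those indexed by $J$ are right variables. A collection of two-faced families is c-bi-free if the corresponding pairs of algebras ($\mathcal{A}_\ell$ = unital algebra generated by the left variables, $\mathcal{A}_r$ = unital algebra generated by the right variables) are c-bi-free with respect to $(\varphi,\psi)$. Convergence in distribution means convergence of all joint moments $\varphi(S_{N,\alpha(1)}\cdots S_{N,\alpha(d)})$ and $\psi(S_{N,\alpha(1)}\cdots S_{N,\alpha(d)})$, $d\ge1$, $\alpha:[d]\to I\sqcup J$, to those of the limit. **c-bi-freeness.** A two-state vector space with a specified state-vector is $(\mathcal{X},\mathcal{X}^\circ,\xi,\varphi)$ with $\mathcal{X}=\mathbb{C}\xi\oplus\mathcal{X}^\circ$ a complex vector space, $\xi\ne0$, $\varphi:\mathcal{X}\to\mathbb{C}$ linear, $\varphi(\xi)=1$. Let $\psi:\mathcal{X}\to\mathbb{C}$ be linear with $\psi(\xi)=1$, $\ker\psi=\mathcal{X}^\circ$, and for $T\in\mathcal{L}(\mathcal{X})$ (linear operators) $\varphi_\xi(T)=\varphi(T\xi)$, $\psi_\xi(T)=\psi(T\xi)$. The c-free product $*_{k\in K}(\mathcal{X}_k,\mathcal{X}_k^\circ,\xi_k,\varphi_k)$ is $\mathcal{X}=\mathbb{C}\xi\oplus\mathcal{X}^\circ$,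 $\mathcal{X}^\circ=\bigoplus_{n\ge1}\bigoplus_{k_1\ne k_2\ne\cdots\ne k_n}\mathcal{X}_{k_1}^\circ\otimes\cdots\otimes\mathcal{X}_{k_n}^\circ$, with $\varphi(\xi)=1$, $\varphi(x_1\otimes\cdots\otimes x_n)=\varphi_{k_1}(x_1)\cdots\varphi_{k_n}(x_n)$. Let $\mathcal{X}(\ell,k)$ (resp. $\mathcal{X}(r,k)$) be the span of $\xi$ and the summands with $k_1\ne k$ (resp. $k_n\ne k$); with the natural identifications $V_k:\mathcal{X}_k\otimes\mathcal{X}(\ell,k)\to\mathcal{X}$, $W_k:\mathcal{X}(r,k)\otimes\mathcal{X}_k\to\mathcal{X}$ put $\lambda_k(T)=V_k(T\otimes I)V_k^{-1}$, $\rho_k(T)=W_k(I\otimes T)W_k^{-1}$. A family $\{(\mathcal{A}_{k,\ell},\mathcal{A}_{k,r})\}_{k\in K}$ of pairs of unital subalgebras is c-bi-free if there are such spaces and unital homomorphisms $\ell_k:\mathcal{A}_{k,\ell}\to\mathcal{L}(\mathcal{X}_k)$, $r_k:\mathcal{A}_{k,r}\to\mathcal{L}(\mathcal{X}_k)$ such that the joint distributions of the family with respect to $\varphi$ and $\psi$ (as functionals on $*_k(\mathcal{A}_{k,\ell}*\mathcal{A}_{k,r})$) equal those of $\{(\lambda_k\circ\ell_k(\mathcal{A}_{k,\ell}),\rho_k\circ r_k(\mathcal{A}_{k,r}))\}_{k\in K}$ with respect to $\varphi_\xi$ and $\psi_\xi$. **Cumulants.** For $\chi:[n]\to\{\ell,r\}$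 with $\chi^{-1}(\ell)=\{i_1<\cdots<i_p\}$, $\chi^{-1}(r)=\{i_{p+1}>\cdots>i_n\}$, let $i_1\prec_\chi\cdots\prec_\chi i_n$; $\mathcal{BNC}(\chi)$ is the set of partitions of $[n]$ non-crossing for $\prec_\chi$. A block $V$ of $\pi\in\mathcal{BNC}(\chi)$ is interior if some other block $W$ of $\pi$ satisfies $\min_{\prec_\chi}W\prec_\chi\min_{\prec_\chi}V$ and $\max_{\prec_\chi}V\prec_\chi\max_{\prec_\chi}W$; otherwise exterior. The $(\ell,r)$-cumulants $\kappa_\chi$ and c-$(\ell,r)$-cumulants $\mathcal{K}_\chi$ are the multilinear functionals on $\mathcal{A}^n$ uniquely determined by $\psi(a_1\cdots a_n)=\sum_{\pi\in\mathcal{BNC}(\chi)}\prod_{V\in\pi}\kappa_{\chi|_V}((a_1,\dots,a_n)|_V)$ and $\varphi(a_1\cdots a_n)=\sum_{\pi\in\mathcal{BNC}(\chi)}\prod_{V\text{ interior}}\kappa_{\chi|_V}((a_1,\dots,a_n)|_V)\prod_{V\text{ exterior}}\mathcal{K}_{\chi|_V}((a_1,\dots,a_n)|_V)$, where restriction to $V$ keeps the entries indexed by $V$ in increasing order. **Centred c-bi-free Gaussian.** A two-faced family $((a_i)_{i\in I},(a_j)_{j\in J})$ has a centred c-bi-free Gaussian distribution (c-bi-free central limit distribution) with covariance matrices $C^\varphi,C^\psi$ if $\varphi(a_{\alpha(1)}a_{\alpha(2)})=C^\varphi_{\alpha(1),\alpha(2)}$ and $\psi(a_{\alpha(1)}a_{\alpha(2)})=C^\psi_{\alpha(1),\alpha(2)}$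 for all $\alpha:[2]\to I\sqcup J$, and $\kappa_{\chi_\alpha}(a_{\alpha(1)},\dots,a_{\alpha(d)})=\mathcal{K}_{\chi_\alpha}(a_{\alpha(1)},\dots,a_{\alpha(d)})=0$ for all $d\ne2$ and $\alpha:[d]\to I\sqcup J$, where $\chi_\alpha(s)=\ell$ if $\alpha(s)\in I$ and $\chi_\alpha(s)=r$ if $\alpha(s)\in J$. *)

(* Defs.v *)
From HB Require Import structures.
From mathcomp Require Import all_boot all_order all_algebra.
From mathcomp Require Import generic_quotient ring_quotient.
From mathcomp Require Import finmap complex monalg.
From mathcomp Require Import boolp classical_sets functions reals topology normedtype.
Import numFieldNormedType.Exports.

Set Implicit Arguments.
Unset Strict Implicit.
Unset Printing Implicit Defensive.

Import GRing.Theory Num.Theory.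
Local Open Scope classical_set_scope.
Local Open Scope ring_scope.
Local Open Scope quotient_scope.

Section SpanQuotient.
Variables (F : fieldType) (V : lmodType F) (G : set V).

Definition lspan : {pred V} :=
  [in smallest (fun S : set V => GRing.submod_closed [in S]) G].

Lemma lspan_gen v : G v -> v \in lspan.
Proof. by move=> Gv; rewrite inE => S [_]; apply. Qed.

Lemma lspan_submod_closed : GRing.submod_closed lspan.
Proof.
split; first by rewrite inE => S [[S0 _] _]; move: S0; rewrite inE.
move=> a x y; rewrite !inE => Sx Sy S SP.
have [_ Slin] := SP.1; have := Slin a x y; rewrite !inE; apply.
  exact: Sx.
exact: Sy.
Qed.

HB.instance Definition _ := GRing.isSubmodClosed.Build F V lspan
  (GRing.submod_closed_semi lspan_submod_closed).

Definition quot_span := {ideal_quot lspan}.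
HB.instance Definition _ := GRing.Zmodule.on quot_span.
HB.instance Definition _ := EqQuotient.on quot_span.
Implicit Types (a b : F) (x y : quot_span).

Lemma pi_spanB : zmod_morphism \pi_quot_span.
Proof. exact: (@pi_is_zmod_morphism _ _ _ {ideal_quot lspan}). Qed.

HB.instance Definition _ :=
  GRing.isZmodMorphism.Build V quot_span \pi_quot_span pi_spanB.

Definition quot_scale a : quot_span -> quot_span := lift_op1 quot_span ( *:%R a).

Lemma pi_scale a : {morph \pi_quot_span : v / a *: v >-> quot_scale a v}.
Proof.
move=> x; unlock quot_scale; apply/eqP; rewrite -Quotient.idealrBE -scalerBr.
by rewrite rpredZ // Quotient.idealrBE reprK.
Qed.

Lemma quot_scaleA a b x : quot_scale a (quot_scale b x) = quot_scale (a * b) x.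
Proof. by rewrite -[x]reprK -!pi_scale scalerA. Qed.

Lemma quot_scale1 : left_id 1 quot_scale.
Proof. by move=> x; rewrite -[x]reprK -pi_scale scale1r. Qed.

Lemma quot_scaleDr : right_distributive quot_scale +%R.
Proof.
by move=> a x y; rewrite -[x]reprK -[y]reprK -raddfD -!pi_scale -raddfD scalerDr.
Qed.

Lemma quot_scaleDl x : {morph quot_scale^~ x : a b / a + b}.
Proof. by move=> a b; rewrite -[x]reprK -!pi_scale -raddfD scalerDl. Qed.

HB.instance Definition _ := GRing.Zmodule_isLmodule.Build F quot_span
  quot_scaleA quot_scale1 quot_scaleDr quot_scaleDl.

Lemma pi_scalable : scalable \pi_quot_span.
Proof. exact: pi_scale. Qed.

HB.instance Definition _ :=
  GRing.isScalable.Build F V quot_span *:%R \pi_quot_span pi_scalable.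

Lemma pi_span_eq u v : u - v \in lspan -> \pi_quot_span u = \pi_quot_span v.
Proof. by rewrite Quotient.idealrBE => /eqP. Qed.

Variables (W : lmodType F) (f : {linear V -> W}).

Definition quot_lift x : W := f (repr x).

Hypothesis f_G : forall v, G v -> f v = 0.

Lemma quot_lift_pi v : quot_lift (\pi_quot_span v) = f v.
Proof.
have: repr (\pi_quot_span v) - v \in lspan by rewrite Quotient.idealrBE reprK.
rewrite inE => /(_ [set u | f u = 0]) h; apply/eqP.
rewrite -subr_eq0 -linearB; apply/eqP; apply: h; split=> //.
split; first by rewrite inE /= linear0.
by move=> a x y; rewrite !inE /= => x0 y0; rewrite linearP x0 y0 scaler0 addr0.
Qed.

Lemma quot_lift_linear : linear quot_lift.
Proof.
move=> a x y; rewrite -[x]reprK -[y]reprK -linearP.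
by rewrite !quot_lift_pi linearP.
Qed.

End SpanQuotient.

Section FreeVectorSpace.
Variables (F : fieldType) (T : choiceType) (W : lmodType F) (g : T -> W).
Implicit Types f : {malg F[T]}.

Definition free_lift f : W := \sum_(t <- msupp f) f@_t *: g t.

Lemma free_liftEw (d : {fset T}) f : (msupp f `<=` d)%fset ->
  free_lift f = \sum_(t <- d) f@_t *: g t.
Proof.
move=> le; rewrite /free_lift (big_fset_incl _ le) // => t _ /mcoeff_outdom ->.
by rewrite scale0r.
Qed.

Lemma free_lift_linear : linear free_lift.
Proof.
move=> a f1 f2.
pose d := (msupp (a *: f1 + f2) `|` msupp f1 `|` msupp f2)%fset.
have d0 : (msupp (a *: f1 + f2) `<=` d)%fset by rewrite /d -fsetUA fsubsetUl.
have d1 : (msupp f1 `<=` d)%fset by rewrite /d fsetUAC fsubsetUr.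
have d2 : (msupp f2 `<=` d)%fset by rewrite /d fsubsetUr.
rewrite (free_liftEw d0) (free_liftEw d1) (free_liftEw d2).
rewrite scaler_sumr -big_split /=; apply: eq_bigr => t _.
by rewrite mcoeffD mcoeffZ scalerA scalerDl.
Qed.

HB.instance Definition _ :=
  GRing.isLinear.Build F {malg F[T]} W *:%R free_lift free_lift_linear.

Lemma free_liftU t : free_lift << t >> = g t.
Proof. by rewrite (free_liftEw msuppU_le) big_seq_fset1 mcoeffUU scale1r. Qed.

End FreeVectorSpace.

(* [X] with [X^o := ker vpsi]: the splitting [X = F xi (+) X^o] is equivalent
   to a linear functional [vpsi] with [vpsi xi = 1] and kernel [X^o]. *)
Record tsvs (F : fieldType) := Tsvs {
  vsort :> lmodType F;
  vxi : vsort;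
  vphi : {scalar vsort};
  vpsi : {scalar vsort};
  vphi_xi : vphi vxi = 1;
  vpsi_xi : vpsi vxi = 1 }.
Arguments vphi {F t}.
Arguments vpsi {F t}.

Section CfreeProduct.
Variables (F : fieldType) (K : choiceType) (X : K -> tsvs F).
Implicit Types (k : K).

Definition word := seq {k : K & X k}.
Implicit Types (w v : word).

Definition lett k (x : X k) : {k : K & X k} := existT (fun k => X k : Type) k x.

(* Words [x_1 ... x_n] with [x_i \in X_{k_i}^o] and [k_1 != k_2 != ... != k_n];
   the empty word stands for [xi]. *)
Definition reduced w : bool :=
  all (fun u => vpsi (tagged u) == 0) w && sorted (fun i j => i != j) (map tag w).

(* [F xi (+) (+)_{n, k_1 != ... != k_n} X_{k_1}^o (x) ... (x) X_{k_n}^o] is the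
   free vector space on all words, modulo the non-reduced words and modulo
   multilinearity in each letter. *)
Definition cf_rel : set {malg F[word]} :=
  [set r | exists2 w, ~~ reduced w & r = << w >>] `|`
  [set r | exists w k (a : F) (x y : X k) v, [/\ vpsi x = 0, vpsi y = 0 &
     r = << w ++ lett (a *: x + y) :: v >>
         - (a *: << w ++ lett x :: v >> + << w ++ lett y :: v >>)]].

Definition cf_sort : lmodType F := quot_span cf_rel.

Definition tens w : cf_sort := \pi_(quot_span cf_rel) << w >>.

Definition multilin (W : lmodType F) (g : word -> W) :=
  forall w k (a : F) (x y : X k) v, vpsi x = 0 -> vpsi y = 0 ->
  g (w ++ lett (a *: x + y) :: v) = a *: g (w ++ lett x :: v) + g (w ++ lett y :: v).

Lemma tens_nonreduced w : ~~ reduced w -> tens w = 0.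
Proof.
move=> nr; rewrite /tens -[RHS](linear0 \pi_(quot_span cf_rel)).
by apply/pi_span_eq; rewrite subr0; apply: lspan_gen; left; exists w.
Qed.

Lemma tens_multilin : multilin tens.
Proof.
move=> w k a x y v x0 y0; rewrite /tens -linearP.
by apply/pi_span_eq/lspan_gen; right; exists w, k, a, x, y, v.
Qed.

Lemma reduced_letter w k (x y : X k) v : vpsi x = 0 -> vpsi y = 0 ->
  reduced (w ++ lett x :: v) = reduced (w ++ lett y :: v).
Proof. by move=> x0 y0; rewrite /reduced !all_cat !map_cat /= x0 y0. Qed.

Section Lift.
Variables (W : lmodType F) (g : word -> W).
Hypothesis g_multilin : multilin g.

Let g_red w : W := if reduced w then g w else 0.

(* Only the values of [g] on reduced words matter: see [cf_lift_tens]. *)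
Definition cf_lift : cf_sort -> W := quot_lift (free_lift g_red).

Lemma cf_lift_rel r : cf_rel r -> free_lift g_red r = 0.
Proof.
move=> [[w nr ->]|[w [k [a [x [y [v [x0 y0 ->]]]]]]]] /=.
  by rewrite free_liftU /g_red (negbTE nr).
have xy0 : vpsi (a *: x + y) = 0 by rewrite linearP /= x0 y0 mulr0 addr0.
rewrite linearB linearP /= !free_liftU /g_red.
rewrite (reduced_letter _ _ x0 xy0) (reduced_letter _ _ y0 xy0).
by case: ifP => _; rewrite ?scaler0 ?addr0 ?subrr // g_multilin ?subrr.
Qed.

Lemma cf_lift_linear : linear cf_lift.
Proof. exact/quot_lift_linear/cf_lift_rel. Qed.

Lemma cf_lift_tens w : reduced w -> cf_lift (tens w) = g w.
Proof.
move=> rw; rewrite /cf_lift quot_lift_pi; last exact: cf_lift_rel.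
by rewrite /= free_liftU /g_red rw.
Qed.

End Lift.

Definition cf_psi_word w : F^o := (w == [::])%:R.

Lemma cf_psi_multilin : multilin cf_psi_word.
Proof. by move=> [|? ?] k a x y v _ _; rewrite /cf_psi_word /= scaler0 addr0. Qed.

Definition cf_phi_word w : F^o := \prod_(u <- w) vphi (tagged u).

Lemma cf_phi_multilin : multilin cf_phi_word.
Proof.
move=> w k a x y v _ _; rewrite /cf_phi_word !big_cat !big_cons /= linearP /=.
by rewrite mulrDl mulrDr -mulrA mulrCA.
Qed.

Definition cf_psi : cf_sort -> F := cf_lift cf_psi_word.
Definition cf_phi : cf_sort -> F := cf_lift cf_phi_word.

Lemma cf_psi_scalar : scalar cf_psi.
Proof. exact: (cf_lift_linear cf_psi_multilin). Qed.

Lemma cf_phi_scalar : scalar cf_phi.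
Proof. exact: (cf_lift_linear cf_phi_multilin). Qed.

HB.instance Definition _ :=
  GRing.isLinear.Build F cf_sort F *%R cf_psi cf_psi_scalar.
HB.instance Definition _ :=
  GRing.isLinear.Build F cf_sort F *%R cf_phi cf_phi_scalar.

Lemma cf_psi_xi : cf_psi (tens [::]) = 1.
Proof. by rewrite /cf_psi cf_lift_tens //; apply: cf_psi_multilin. Qed.

Lemma cf_phi_xi : cf_phi (tens [::]) = 1.
Proof.
rewrite /cf_phi cf_lift_tens //; last exact: cf_phi_multilin.
by rewrite /cf_phi_word big_nil.
Qed.

Definition cfree_product : tsvs F := Tsvs cf_phi_xi cf_psi_xi.

Definition deg0 k (x : X k) : X k := x - vpsi x *: vxi (X k).

Lemma vpsi_deg0 k (x : X k) : vpsi (deg0 x) = 0.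
Proof. by rewrite linearB linearZ /= vpsi_xi mulr1 subrr. Qed.

Lemma deg0_linear k : linear (@deg0 k).
Proof.
move=> a x y; rewrite /deg0 linearP /= scalerDl -scalerA opprD.
by rewrite scalerBr addrACA.
Qed.

(* [V_k (x (x) w)] for a reduced word [w] of [X(l,k)], i.e. one whose first
   letter is not in [X_k], and [W_k (w (x) x)] for [w] in [X(r,k)]. *)
Definition cf_V k (x : X k) w : cf_sort :=
  vpsi x *: tens w + tens (lett (deg0 x) :: w).
Definition cf_W k w (x : X k) : cf_sort :=
  vpsi x *: tens w + tens (rcons w (lett (deg0 x))).

(* The component [x \in X_k] of [V_k^-1 (u :: w)] (resp. [W_k^-1 (rcons w u)]):
   [u] itself if [u] is in [X_k], and [xi_k] otherwise. *)
Definition fst_in k (u : {k : K & X k}) : X k := tagged_as (lett (vxi (X k))) u.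

(* [V_k (T (x) 1) V_k^-1 w] and [W_k (1 (x) T) W_k^-1 w] for reduced [w]. *)
Definition lambda_word k (T : X k -> X k) w : cf_sort :=
  if w is u :: v then cf_V (T (fst_in k u)) (if tag u == k then v else w)
  else cf_V (T (vxi (X k))) [::].

Definition rho_word k (T : X k -> X k) w : cf_sort :=
  if rev w is u :: v then cf_W (if tag u == k then rev v else w) (T (fst_in k u))
  else cf_W [::] (T (vxi (X k))).

Lemma fst_in_eq k (x : X k) : fst_in k (lett x) = x.
Proof.
rewrite /fst_in /tagged_as.
case: eqP => [e|[]//] /=.
by rewrite (eq_axiomK e).
Qed.

Lemma fst_in_neq k (u : {k : K & X k}) : tag u != k -> fst_in k u = vxi (X k).
Proof.
rewrite /fst_in /tagged_as /=; case: eqP => [e|//] /eqP; by case.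
Qed.

Lemma cf_V_linear k w : linear (fun x : X k => cf_V x w).
Proof.
move=> a x y; rewrite /cf_V deg0_linear linearP /=.
rewrite (@tens_multilin [::]) ?vpsi_deg0 //= scalerDl -scalerA scalerDr.
by rewrite addrACA.
Qed.

Lemma cf_W_linear k w : linear (fun x : X k => cf_W w x).
Proof.
move=> a x y; rewrite /cf_W deg0_linear linearP /= -!cats1.
rewrite tens_multilin ?vpsi_deg0 //= scalerDl -scalerA scalerDr.
by rewrite addrACA.
Qed.

Lemma cf_V_multilin k (x : X k) : multilin (cf_V x).
Proof.
move=> w j a y z v y0 z0; rewrite /cf_V tens_multilin // -cat_cons.
by rewrite tens_multilin //= !scalerDr !scalerA addrACA mulrC.
Qed.

Lemma cf_W_multilin k (x : X k) : multilin (fun w => cf_W w x).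
Proof.
move=> w j a y z v y0 z0; rewrite /cf_W tens_multilin // !rcons_cat /=.
by rewrite tens_multilin //= !scalerDr !scalerA addrACA mulrC.
Qed.

Lemma lambda_word_multilin k (T : {linear X k -> X k}) : multilin (lambda_word T).
Proof.
move=> [|u w] j a x y v x0 y0 /=; last first.
  by case: ifP => _; [|rewrite -!cat_cons]; apply: cf_V_multilin.
case: eqVneq => [e|ne].
  by case: _ / e T => T; rewrite !fst_in_eq linearP cf_V_linear.
by rewrite !fst_in_neq // (@cf_V_multilin _ _ [::]).
Qed.

Lemma rho_word_multilin k (T : {linear X k -> X k}) : multilin (rho_word T).
Proof.
move=> w j a x y v x0 y0; rewrite /rho_word.
case: (lastP v) => [|{}v u]; last first.
  rewrite -!rcons_cons -!rcons_cat !rev_rcons /= !revK.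
  by case: ifP => _; rewrite ?rcons_cat ?rcons_cons; apply: cf_W_multilin.
rewrite !cats1 !rev_rcons /=.
case: eqVneq => [e|ne].
  by case: _ / e T => T; rewrite !fst_in_eq linearP cf_W_linear.
by rewrite !fst_in_neq // -!cats1 cf_W_multilin.
Qed.

Section Operators.
Variables (k : K) (T : {linear X k -> X k}).

Definition lambda : cfree_product -> cfree_product := cf_lift (lambda_word T).
Definition rho : cfree_product -> cfree_product := cf_lift (rho_word T).

Lemma lambda_linear : linear lambda.
Proof. exact/cf_lift_linear/lambda_word_multilin. Qed.

Lemma rho_linear : linear rho.
Proof. exact/cf_lift_linear/rho_word_multilin. Qed.

HB.instance Definition _ :=
  GRing.isLinear.Build F cfree_product cfree_product *:%R lambda lambda_linear.
HB.instance Definition _ :=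
  GRing.isLinear.Build F cfree_product cfree_product *:%R rho rho_linear.

Lemma lambda_tens w : reduced w -> lambda (tens w) = lambda_word T w.
Proof. exact/cf_lift_tens/lambda_word_multilin. Qed.

Lemma rho_tens w : reduced w -> rho (tens w) = rho_word T w.
Proof. exact/cf_lift_tens/rho_word_multilin. Qed.

Let splitE (x : X k) : vpsi x *: vxi (X k) + deg0 x = x.
Proof. by rewrite /deg0 addrC subrK. Qed.

(* [lambda_k T \o V_k = V_k \o (T (x) 1)] and [rho_k T \o W_k = W_k \o (1 (x) T)]. *)
Lemma lambda_V x w : reduced w -> (if w is u :: _ then tag u != k else true) ->
  lambda (cf_V x w) = cf_V (T x) w.
Proof.
move=> rw hw; rewrite -[x in RHS]splitE linearP cf_V_linear.
transitivity (vpsi x *: lambda (tens w) + lambda (tens (lett (deg0 x) :: w))).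
  exact: linearP.
congr (_ *: _ + _).
  rewrite lambda_tens //.
  by case: w hw {rw} => //= u w uk; rewrite (negbTE uk) fst_in_neq.
rewrite lambda_tens; first by rewrite /= eqxx fst_in_eq.
move: rw hw; rewrite /reduced /= vpsi_deg0 eqxx /=; case: w => //= u w.
by move=> /andP[-> ->]; rewrite eq_sym => ->.
Qed.

Lemma rho_W x w : reduced w -> (if rev w is u :: _ then tag u != k else true) ->
  rho (cf_W w x) = cf_W w (T x).
Proof.
move=> rw hw; rewrite -[x in RHS]splitE linearP cf_W_linear.
transitivity (vpsi x *: rho (tens w) + rho (tens (rcons w (lett (deg0 x))))).
  exact: linearP.
congr (_ *: _ + _).
  rewrite rho_tens // /rho_word.
  case: (lastP w) hw {rw} => //= {}w u; rewrite rev_rcons => uk.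
  by rewrite (negbTE uk) fst_in_neq.
rewrite rho_tens; first by rewrite /rho_word rev_rcons /= eqxx revK fst_in_eq.
move: rw hw; rewrite /reduced all_rcons /= vpsi_deg0 eqxx /= map_rcons.
case: (lastP w) => //= {}w u; rewrite rev_rcons map_rcons => /andP[-> +] uk /=.
case: (map _ w) => [|i s] /=; first by rewrite uk.
by rewrite !rcons_path last_rcons uk => ->.
Qed.

End Operators.

End CfreeProduct.

Record ncps2 (F : fieldType) := Ncps2 {
  nalg :> algType F;
  nphi : {scalar nalg};
  npsi : {scalar nalg};
  nphi1 : nphi 1 = 1;
  npsi1 : npsi 1 = 1 }.
Arguments nphi {F _}.
Arguments npsi {F _}.

Section Cbifree.
Variables (F : fieldType) (A : ncps2 F).

Definition gen_subalg (G : set A) : set A :=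
  smallest (fun S : set A => GRing.subalg_closed [in S]) G.

(* [f] restricts to a unital homomorphism [S -> L(X)]; outside of [S] the values
   of [f] are irrelevant. *)
Definition unital_hom_on (X : lmodType F) (S : set A) (f : A -> {linear X -> X}) :=
  [/\ forall v, f 1 v = v,
      forall c a b, S a -> S b -> forall v, f (c *: a + b) v = c *: f a v + f b v &
      forall a b, S a -> S b -> forall v, f (a * b) v = f a (f b v)].

(* A letter [(k, s, a)] is the element [a] of the left ([s = true]) or right
   ([s = false]) algebra with index [k]; words in such letters span the free
   product of the algebras, so joint distributions are compared on words. *)
Definition cbifree (K : choiceType) (Al Ar : K -> set A) : Prop :=
  exists (X : K -> tsvs F) (l r : forall k, A -> {linear X k -> X k}),
    [/\ forall k, unital_hom_on (Al k) (l k),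
        forall k, unital_hom_on (Ar k) (r k) &
        forall s : seq (K * bool * A),
          (forall t, t \in s -> (if t.1.2 then Al t.1.1 else Ar t.1.1) t.2) ->
          let v := foldr (fun t => if t.1.2 then lambda (l t.1.1 t.2)
                                   else rho (r t.1.1 t.2))
                         (vxi (cfree_product X)) s in
          nphi (\prod_(t <- s) t.2) = vphi v /\ npsi (\prod_(t <- s) t.2) = vpsi v].

(* [I] indexes the left variables and [J] the right ones. *)
Definition cbifree_families (K : choiceType) (I J : Type) (a : K -> I + J -> A) :=
  cbifree (fun k => gen_subalg (range (fun i => a k (inl i))))
          (fun k => gen_subalg (range (fun j => a k (inr j)))).

End Cbifree.

Section BiNonCrossing.
Variables (n : nat) (chi : 'I_n -> bool).
Implicit Types (i j : 'I_n) (V W : {set 'I_n}) (P : {set {set 'I_n}}).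

(* [chi i] is [true] for [l] and [false] for [r]. *)
Definition chi_lt i j : bool :=
  match chi i, chi j with
  | true, true => (i < j)%N
  | true, false => true
  | false, true => false
  | false, false => (j < i)%N
  end.

Definition noncrossing P : bool :=
  [forall V in P, forall W in P, (V != W) ==>
    ~~ [exists i in V, exists k in W, exists j in V, exists l in W,
        [&& chi_lt i k, chi_lt k j & chi_lt j l]]].

Definition bnc : {set {set {set 'I_n}}} :=
  [set P : {set {set 'I_n}} | finset.partition P [set: 'I_n] && noncrossing P]%SET.

Definition is_chi_min V i : bool :=
  (i \in V) && [forall j in V, (j != i) ==> chi_lt i j].
Definition is_chi_max V i : bool :=
  (i \in V) && [forall j in V, (j != i) ==> chi_lt j i].

Definition interior P V : bool :=
  [exists W in P, (W != V) &&
    [exists w1, exists v1, exists v2, exists w2,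
      [&& is_chi_min W w1, is_chi_min V v1, is_chi_max V v2, is_chi_max W w2,
          chi_lt w1 v1 & chi_lt v2 w2]]].

End BiNonCrossing.

Section Cumulants.
Variables (F : fieldType) (A : ncps2 F).

(* A family of functionals [kappa_chi : A^n -> F] for all [n] and
   [chi : [n] -> {l, r}] is encoded as one functional on words of pairs
   [(chi i, a_i)]. *)
Implicit Types kappa Kappa : seq (bool * A) -> F.

Definition multilinear kappa : Prop :=
  forall s s' c (x : F) (a b : A),
    kappa (s ++ (c, x *: a + b) :: s')
    = x * kappa (s ++ (c, a) :: s') + kappa (s ++ (c, b) :: s').

Definition restr n (chi : 'I_n -> bool) (a : 'I_n -> A) (V : {set 'I_n}) :
    seq (bool * A) :=
  [seq (chi i, a i) | i <- enum V].

Definition lr_cumulants kappa : Prop :=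
  multilinear kappa /\
  forall n (chi : 'I_n -> bool) (a : 'I_n -> A), (0 < n)%N ->
    npsi (\prod_(i < n) a i)
    = \sum_(P in bnc chi) \prod_(V in P) kappa (restr chi a V).

Definition c_lr_cumulants kappa Kappa : Prop :=
  multilinear Kappa /\
  forall n (chi : 'I_n -> bool) (a : 'I_n -> A), (0 < n)%N ->
    nphi (\prod_(i < n) a i)
    = \sum_(P in bnc chi)
        (\prod_(V in P | interior chi P V) kappa (restr chi a V)) *
        (\prod_(V in P | ~~ interior chi P V) Kappa (restr chi a V)).

Variables I J : Type.

Definition in_left (k : I + J) : bool := if k is inl _ then true else false.

Definition centred_cbifree_gaussian (a : I + J -> A) (Cphi Cpsi : I + J -> I + J -> F) :=
  (forall k p, nphi (a k * a p) = Cphi k p /\ npsi (a k * a p) = Cpsi k p) /\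
  exists kappa Kappa,
    [/\ lr_cumulants kappa, c_lr_cumulants kappa Kappa &
        forall s : seq (I + J), (0 < size s)%N -> size s != 2 ->
          kappa [seq (in_left k, a k) | k <- s] = 0 /\
          Kappa [seq (in_left k, a k) | k <- s] = 0].

End Cumulants.

Section Convergence.
Variable R : realType.
Local Open Scope complex_scope.

Definition cvg_complex (u : nat -> R[i]) (l : R[i]) : Prop :=
  (u : nat -> R[i]^o) @ \oo --> (l : R[i]^o).

Definition cvg_distribution (A B : ncps2 R[i]) (T : Type)
    (S : nat -> T -> A) (b : T -> B) : Prop :=
  forall s : seq T, (0 < size s)%N ->
    cvg_complex (fun N => nphi (\prod_(k <- s) S N k)) (nphi (\prod_(k <- s) b k)) /\
    cvg_complex (fun N => npsi (\prod_(k <- s) S N k)) (npsi (\prod_(k <- s) b k)).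

Definition bounded_seq (u : nat -> R[i]) : Prop :=
  exists M : R, forall n, `|u n| <= M%:C.

End Convergence.

(* Main.v *)
(** A letter [c] of a product of operators on the c-free product space acts on a
    tensor only at its left or right end: if the centred operator does not meet
    its own label there, it appends a new letter; otherwise the two letters are
    contracted to a scalar plus a letter which is never touched again.  Order
    the labels of the operators still to be applied and of the current tensor by
    the chi-order.  When every label occurs twice, the value of the functional
    depends on this word of labels only, and contracting two adjacent letters
    [n n] replaces it by [psi_n] times the word without [n], plus the word with a
    single [n] of weight [phi_n - psi_n].  Letters under an arc contribute [0] in
    the end, so a pair weighs [psi_n] if it is covered and [phi_n] if it is
    exposed: the mixed moment is the product over interior and exterior blocks
    if the pairing is bi-non-crossing and [0] otherwise.  A label occurring once
    gives [0], and mixed moments are bounded uniformly in the labels.  Expanding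
    a moment of [S_N] over all [f : [d] -> [N]], the [f] with fewer than [d/2]
    values are negligible, and the remaining nonzero terms are those whose fibres
    are pairs; they yield the sum over bi-non-crossing pairings, which is a moment
    of the Gaussian family realized on the free algebra.  The functional [psi] is
    the special case [phi := psi]. *)

From HB Require Import structures.
Require Import Defs.
From mathcomp Require Import all_boot all_order all_algebra.
From mathcomp Require Import finmap complex monalg.
From mathcomp Require Import boolp reals.
From mathcomp Require topology normedtype.

Set Implicit Arguments.
Unset Strict Implicit.
Unset Printing Implicit Defensive.

Import Order.TTheory GRing.Theory Num.Theory.
Local Open Scope ring_scope.
Local Open Scope complex_scope.

(** * Words of labels *)

Section Lists.
Variable (T : eqType).
Implicit Types (a b m n : T) (s X Y Z : seq T).

Definition crossing Z := has (fun a => has (fun b =>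
  (a != b) && subseq [:: a; b; a; b] Z) Z) Z.

Definition covered n Z := has (fun m => (m != n) && subseq [:: m; n; m] Z) Z.

Lemma crossingP Z : reflect (exists a b, a != b /\ subseq [:: a; b; a; b] Z) (crossing Z).
Proof.
apply: (iffP hasP) => [[a _ /hasP[b _ /andP[]]]|[a [b [ab sZ]]]]; first by exists a, b.
have aZ := mem_subseq sZ; exists a; first by rewrite aZ ?inE ?eqxx ?orbT.
by apply/hasP; exists b; rewrite ?ab // aZ ?inE ?eqxx ?orbT.
Qed.

Lemma coveredP n Z : reflect (exists m, m != n /\ subseq [:: m; n; m] Z) (covered n Z).
Proof.
apply: (iffP hasP) => [[a _ /andP[]]|[a [an sZ]]]; first by exists a.
by exists a; rewrite ?an // (mem_subseq sZ) ?inE ?eqxx ?orbT.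
Qed.

Lemma subseq_drop_notin n s X Y : n \notin s -> subseq s (X ++ n :: Y) = subseq s (X ++
  Y).
Proof.
move=> ns; have sE Z : subseq s Z = subseq s [seq z <- Z | z != n].
  by rewrite subseq_filter [all _ _](introT allP) // => x xs /=;
    apply: contraNneq ns => <-.
by rewrite sE filter_cat /= eqxx /= -filter_cat -sE.
Qed.

Lemma subseq_skip n s X Z : n \notin X -> subseq (n :: s) (X ++ Z) = subseq (n :: s) Z.
Proof.
by elim: X => //= x X IH; rewrite inE negb_or => /andP[/negPf -> /IH].
Qed.

Lemma nsubseq_between n b X Y : n \notin X -> n \notin Y -> b != n ->
  subseq [:: n; b; n] (X ++ n :: n :: Y) = false.
Proof.
move=> nX nY bn; rewrite subseq_skip //= eqxx (negPf bn).
by apply/negP => /mem_subseq/(_ n); rewrite !inE eqxx orbT (negPf nY) => /(_ isT).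
Qed.

Lemma nsubseq_count n s Z : (count_mem n Z < count_mem n s)%N -> subseq s Z = false.
Proof. by move=> h; apply/negP => /(leq_count_subseq (pred1 n)); rewrite leqNgt h. Qed.

Section Insert.
Variables (n : T) (X Y : seq T).
Hypotheses (nX : n \notin X) (nY : n \notin Y).

Let cX : count_mem n X = 0%N. Proof. exact/count_memPn. Qed.
Let cY : count_mem n Y = 0%N. Proof. exact/count_memPn. Qed.

Lemma subseq_pair_notin s : n \notin s -> subseq s (X ++ n :: n :: Y) = subseq s (X ++ Y).
Proof. by move=> ns; rewrite subseq_drop_notin // subseq_drop_notin. Qed.

(** Each letter of the pattern [[:: a; b; a; b]] is used twice, so a letter occurring only once
    takes no part in a crossing. *)
Lemma crossing_insert1 : crossing (X ++ n :: Y) = crossing (X ++ Y).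
Proof.
apply/crossingP/crossingP => -[a [b [ab]]] h; exists a, b; split=> //; last first.
  by apply: subseq_trans h _; rewrite cat_subseq // subseq_cons.
have [nn|] := boolP (n \notin [:: a; b; a; b]);
  first by rewrite -(subseq_drop_notin _ _ nn).
move=> nn; move: h; rewrite (@nsubseq_count n) // count_cat /= cX cY eqxx.
by move: nn; rewrite negbK !inE ![n == _]eq_sym => /or4P[] /eqP -> //; rewrite eqxx;
  case: eqP.
Qed.

(** A crossing contains both [[:: a; b; a]] and [[:: b; a; b]]; since nothing lies between the two
    adjacent copies of [n], neither letter can be [n]. *)
Lemma crossing_insert2 : crossing (X ++ n :: n :: Y) = crossing (X ++ Y).
Proof.
apply/crossingP/crossingP => -[a [b [ab]]] h; exists a, b; split=> //; last first.
  by apply: subseq_trans h _;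
    rewrite cat_subseq // -[Y in subseq Y]cat0s (@cat_subseq _ _ _ [:: n; n]).
have [nn|nn] := boolP (n \notin [:: a; b; a; b]);
  first by rewrite -(subseq_pair_notin nn).
have [na|na] := eqVneq n a.
  have s : subseq [:: a; b; a] [:: a; b; a; b] by exact: (prefix_subseq _ [:: b]).
  by move: (subseq_trans s h); rewrite -na nsubseq_between // na eq_sym.
have nb : n = b by move: nn; rewrite negbK !inE (negPf na) /= orbb => /eqP.
have s : subseq [:: b; a; b] [:: a; b; a; b] by exact: subseq_cons.
by move: (subseq_trans s h); rewrite -nb nsubseq_between // nb.
Qed.

Lemma covered_insert1 m : m != n -> covered m (X ++ n :: Y) = covered m (X ++ Y).
Proof.
move=> mn; apply/coveredP/coveredP => -[a [am]] h; exists a; split=> //; last first.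
  by apply: subseq_trans h _; rewrite cat_subseq // subseq_cons.
have [an|an] := eqVneq a n.
  by move: h; rewrite an (@nsubseq_count n) // count_cat /= cX cY eqxx (negPf mn).
by rewrite -(@subseq_drop_notin n) // !inE !(eq_sym n) (negPf an) (negPf mn).
Qed.

Lemma covered_insert2 m : m != n -> covered m (X ++ n :: n :: Y) = covered m (X ++ Y).
Proof.
move=> mn; apply/coveredP/coveredP => -[a [am]] h; exists a; split=> //; last first.
  by apply: subseq_trans h _;
    rewrite cat_subseq // -[Y in subseq Y]cat0s (@cat_subseq _ _ _ [:: n; n]).
have [an|an] := eqVneq a n; first by move: h; rewrite an nsubseq_between.
by rewrite -subseq_pair_notin // !inE !(eq_sym n) (negPf an) (negPf mn).
Qed.

(** The pattern [[:: a; n; a]] uses a single [n], and adjacent copies have the same other letters on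
    either side. *)
Lemma covered_pair : covered n (X ++ n :: n :: Y) = covered n (X ++ n :: Y).
Proof.
apply/coveredP/coveredP => -[a [an]] h; exists a; split=> //; last first.
  by apply: subseq_trans h _; rewrite cat_subseq // (subseq_cons (n :: Y)).
elim: X nX h => [|x X' IH] /=.
  move=> _; rewrite !(negPf an) => /mem_subseq/(_ n).
  by rewrite !inE eqxx orbT (negPf nY) => /(_ isT).
rewrite inE negb_or => /andP[nx nX']; case: ifP => _; last exact: IH.
by rewrite !subseq_skip //= !eqxx (negPf an).
Qed.

End Insert.

Lemma count1_uniq s : (forall n, (count_mem n s <= 1)%N) -> uniq s.
Proof.
move=> h; apply: count_mem_uniq => x; have := h x.
by case: (boolP (x \in s)) => [|/count_memPn ->//]; rewrite -has_pred1 has_count;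
  case: count => [|[]].
Qed.

End Lists.

(** * Weights of words of labels *)

Section Weights.
Variables (F : comNzRingType) (cpsi ctheta : nat -> F) (N : nat).
Implicit Types (n h : nat) (Z X Y W : seq nat).

(* The labels occurring once stand for closed pairs kept in a tensor. *)
Definition wt Z n : F :=
  match count_mem n Z with
  | 0 => 1
  | 1 => if covered n Z then 0 else ctheta n - cpsi n
  | _ => if covered n Z then cpsi n else ctheta n
  end.

Definition weight Z : F := if crossing Z then 0 else \prod_(n < N) wt Z n.

(** Only the factor of [n] distinguishes the three words. If [n] is covered, the identity reads
    [cpsi n = cpsi n + 0]; otherwise it reads [ctheta n = cpsi n + (ctheta n - cpsi n)]. *)
Lemma weight_pair n X Y : (n < N)%N -> n \notin X -> n \notin Y ->
  weight (X ++ n :: n :: Y) = cpsi n * weight (X ++ Y) + weight (X ++ n :: Y).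
Proof.
move=> nN nX nY; rewrite /weight crossing_insert2 // crossing_insert1 //.
case: ifP => _; first by rewrite mulr0 addr0.
have cX : count_mem n X = 0%N by exact/count_memPn.
have cY : count_mem n Y = 0%N by exact/count_memPn.
have D1 Z : \prod_(i < N) wt Z i = wt Z n * \prod_(i < N | i != Ordinal nN) wt Z i.
  by rewrite (bigD1 (Ordinal nN)).
rewrite !D1; pose Q := \prod_(i < N | i != Ordinal nN) wt (X ++ Y) i.
have QE Z : (forall m : nat, m != n -> count_mem m Z = count_mem m (X ++ Y)) ->
  (forall m : nat, m != n -> covered m Z = covered m (X ++ Y)) ->
  \prod_(i < N | i != Ordinal nN) wt Z i = Q.
  by move=> hc hv; apply: eq_bigr => i iN; rewrite /wt hc ?hv.
have c1 (m : nat) : m != n -> (n == m) = false by rewrite eq_sym => /negPf.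
rewrite (QE (X ++ n :: n :: Y)); first 1 last.
- by move=> m mn; rewrite !count_cat /= !c1.
- by move=> m mn; rewrite covered_insert2.
rewrite (QE (X ++ n :: Y)); first 1 last.
- by move=> m mn; rewrite !count_cat /= !c1.
- by move=> m mn; rewrite covered_insert1.
rewrite -/Q /wt !count_cat /= eqxx cX cY /= mul1r covered_pair // -mulrDl;
  case: ifP => _; first by rewrite addr0.
by rewrite addrC subrK.
Qed.

(** This is the end of the recursion, where no operator is left and every letter of the tensor is a
    closed pair: a crossing or a covering would repeat a label. *)
Lemma weight_uniq Z : uniq Z -> all (fun n => (n < N)%N) Z ->
  weight Z = \prod_(n <- Z) (ctheta n - cpsi n).
Proof.
move=> uZ /allP ZN; rewrite /weight.
have c1 n : (count_mem n Z <= 1)%N by rewrite count_uniq_mem // leq_b1.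
rewrite (_ : crossing Z = false); last first.
  apply/negP => /crossingP[a [b [ab]]]; rewrite (@nsubseq_count _ a) //.
  by apply: leq_ltn_trans (c1 a) _; rewrite /= !eqxx; case: eqP.
have cov n : covered n Z = false.
  apply/negP => /coveredP[a [an]]; rewrite (@nsubseq_count _ a) //.
  by apply: leq_ltn_trans (c1 a) _; rewrite /= !eqxx; case: eqP.
rewrite (eq_bigr (fun i : 'I_N => if val i \in Z then ctheta i - cpsi i else 1));
  last first.
  by move=> i _; rewrite /wt cov count_uniq_mem //; case: (_ \in Z).
rewrite -(big_mkord xpredT (fun n => if n \in Z then ctheta n - cpsi n else 1)).
rewrite -big_mkcond /= -big_filter; apply: perm_big; apply: uniq_perm => //.
  by rewrite filter_uniq // iota_uniq.
move=> n; rewrite mem_filter mem_index_iota /=; case: (boolP (n \in Z)) => //= nZ.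
exact: ZN.
Qed.

Lemma weight_crossing Z a b : a != b -> subseq [:: a; b; a; b] Z -> weight Z = 0.
Proof. by move=> ab h; rewrite /weight (introT (crossingP Z)) //; exists a, b. Qed.

Lemma weight_covered Z n h : (h < N)%N -> count_mem h Z = 1%N -> n != h ->
  subseq [:: n; h; n] Z -> weight Z = 0.
Proof.
move=> hN h1 nh s; rewrite /weight; case: ifP => // _.
rewrite (bigD1 (Ordinal hN)) //= /wt h1 (introT (coveredP _ _)) ?mul0r //.
by exists n.
Qed.

(** The letter [h] separates an operator [n] from its partner in the tensor, which gives the pattern
    [n h n]. If the partner of [h] is still to come, on either side, it completes a crossing; if [h]
    is a closed pair, it is covered and has weight [0]. *)
Lemma weight_blocked Z X W V Y n h : (h < N)%N -> n != h ->
  (Z = X ++ W ++ Y) -> (W = n :: h :: V \/ W = rcons (rcons V h) n) -> n \in V ->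
  [\/ h \in X, h \in Y | count_mem h Z = 1%N] -> weight Z = 0.
Proof.
move=> hN nh ZE WE nV hh.
have sV : subseq [:: n] V by rewrite sub1seq.
have sW : subseq [:: n; h; n] W.
  case: WE => ->; first by rewrite /= !eqxx sub1seq.
  rewrite -!cats1 -catA /= (_ : [:: n; h; n] = [:: n] ++ [:: h; n]) //.
  exact: cat_subseq.
have sZ : subseq W Z by rewrite ZE -[W in subseq W]cat0s cat_subseq ?sub0seq //
  prefix_subseq.
case: hh => [hX|hY|h1].
- apply: (@weight_crossing _ h n); first by rewrite eq_sym.
  rewrite ZE (_ : [:: h; n; h; n] = [:: h] ++ ([:: n; h; n] ++ [::])) //.
  by rewrite !cat_subseq ?sub1seq ?sub0seq.
- apply: (@weight_crossing _ n h); rewrite // ZE.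
  rewrite (_ : [:: n; h; n; h] = [::] ++ ([:: n; h; n] ++ [:: h])) //.
  by rewrite !cat_subseq ?sub1seq ?sub0seq.
exact: (@weight_covered _ n h hN h1 nh (subseq_trans sW sZ)).
Qed.

End Weights.

(** * Operators on the c-free product space *)

(** Left operators work at the head of a word and right operators at its end; [put] lets both share
    one statement. *)
Definition put (U : Type) (s : bool) (x : U) w := if s then x :: w else rcons w x.

Lemma map_put (U V : Type) (f : U -> V) s x w :
  map f (put s x w) = put s (f x) (map f w).
Proof. by case: s; rewrite //= map_rcons. Qed.

Lemma put_inj (U : Type) s (x y : U) v w : put s x v = put s y w -> x = y /\ v = w.
Proof. by case: s => [[]|/rcons_inj[]]. Qed.

Lemma putP (U : Type) s (w : seq U) : w = [::] \/ exists x v, w = put s x v.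
Proof.
case: s; first by case: w => [|x v]; [left|right; exists x, v].
by case/lastP: w => [|v x]; [left|right; exists x, v].
Qed.

Section Words.
Variables (F : fieldType) (X : nat -> tsvs F).
Variables (T : Type) (side : T -> bool) (tau : forall n, T -> {linear X n -> X n}).
Notation P := (cfree_product X).
Notation word := (word X).
Implicit Types (n m : nat) (t : T) (w : word) (u : seq (nat * T)).



Definition op (c : nat * T) : P -> P :=
  if side c.2 then lambda (tau c.1 c.2) else rho (tau c.1 c.2).

Lemma op_linear c : linear (op c).
Proof. by rewrite /op; case: side => a x y; rewrite linearP. Qed.

HB.instance Definition _ c := GRing.isLinear.Build F P P *:%R (op c) (op_linear c).

(** Says that the tensor of a reduced [w] lies in X(l,n) or X(r,n), according to [s], so that an
    operator on [X n] meets the component [xi] there. *)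
Definition free_end s n w :=
  if s then (if w is y :: _ then tag y != n else true)
  else (if rev w is y :: _ then tag y != n else true).

Lemma endP s n w : free_end s n w \/ exists x w', w = put s (@lett _ _ X n x) w'.
Proof.
rewrite /free_end /put; case: s.
  case: w => [|[m x] w]; first by left.
  by case: (eqVneq m n) => [<-|ne]; [right; exists x, w|left].
case: (lastP w) => [|{}w [m x]]; first by left.
rewrite rev_rcons.
by case: (eqVneq m n) => [<-|ne]; [right; exists x, w|left].
Qed.

Lemma reduced_put s n (x : X n) w : vpsi x = 0 ->
  reduced (put s (lett x) w) = free_end s n w && reduced w.
Proof.
move=> x0; rewrite /free_end /put; case: s.
  rewrite /reduced /= x0 eqxx /=; case: w => //= y w.
  by rewrite [n == _]eq_sym andbCA.
rewrite /reduced all_rcons /= x0 eqxx /= map_rcons.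
case: (lastP w) => //= {}w y; rewrite rev_rcons map_rcons.
case: (map _ w) => [|i r] /=; first by rewrite andbC !andbT andbC.
by rewrite !rcons_path last_rcons andbA andbC.
Qed.

Lemma reduced_put_vpsi s n (x : X n) w : reduced (put s (lett x) w) -> vpsi x = 0.
Proof.
by rewrite /reduced /put; case: s; rewrite ?all_rcons /= => /andP[/andP[/eqP->]].
Qed.

Lemma deg0_id n (x : X n) : vpsi x = 0 -> deg0 x = x.
Proof. by rewrite /deg0 => ->; rewrite scale0r subr0. Qed.

Lemma op_out n t w : reduced w -> free_end (side t) n w ->
  op (n, t) (tens w) = vpsi (tau n t (vxi _)) *: tens w
    + tens (put (side t) (lett (deg0 (tau n t (vxi _)))) w).
Proof.
move=> rw; rewrite /op /free_end /put /=; case: side => h.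
  rewrite lambda_tens // /lambda_word; case: w rw h => //= y w rw h.
  by rewrite fst_in_neq // (negbTE h).
rewrite rho_tens // /rho_word; case: (rev w) (revK w) h => [/= <- //|y v /= wE h].
by rewrite (negbTE h) fst_in_neq.
Qed.

Lemma op_in n t (x : X n) w : reduced (put (side t) (lett x) w) ->
  op (n, t) (tens (put (side t) (lett x) w)) = vpsi (tau n t x) *: tens w
    + tens (put (side t) (lett (deg0 (tau n t x))) w).
Proof.
move=> rw; rewrite /op /=; move: rw; rewrite /put; case: side => rw.
  by rewrite lambda_tens //= eqxx fst_in_eq.
by rewrite rho_tens // /rho_word rev_rcons /= eqxx fst_in_eq revK.
Qed.

Definition act u (v : P) : P := foldr op v u.

Lemma act_linear u : linear (act u).
Proof. by elim: u => [|c u IH] a x y //=; rewrite IH linearP. Qed.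

HB.instance Definition _ u := GRing.isLinear.Build F P P *:%R (act u) (act_linear u).

Lemma act_rcons u c v : act (rcons u c) v = act u (op c v).
Proof. by rewrite /act foldr_rcons. Qed.

Lemma act_cat u u' v : act (u ++ u') v = act u (act u' v).
Proof. by rewrite /act foldr_cat. Qed.

Definition locact n (s : seq T) (x : X n) : X n := foldr (tau n) x s.

(** [theta] and [Theta] stand for [vphi] on the factors and on the product, and later also for
    [vpsi], so that both states are handled at once. *)
Variables (theta : forall n, {scalar X n}) (Theta : {scalar P}).
Hypothesis theta_xi : forall n, theta n (vxi _) = 1.
Hypothesis ThetaE : forall w, reduced w ->
  Theta (tens w) = \prod_(y <- w) theta (tag y) (tagged y).

Lemma Theta_xi : Theta (tens [::]) = 1.
Proof. by rewrite ThetaE // big_nil. Qed.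

Lemma tens0 w n v : tens (w ++ lett (0 : X n) :: v) = 0.
Proof.
(* Linearity in the letter [-1 *: 0 + 0 = 0] writes the tensor as its own negative plus itself. *)
have := tens_multilin w (-1) v (linear0 (@vpsi _ (X n))) (linear0 (@vpsi _ (X n))).
by rewrite scaler0 addr0 => ->; rewrite scaleN1r addNr.
Qed.

(** Operators with one common label never leave the copy of [X n] formed by [xi] and the words of
    one letter, and there the left and right actions of an operator coincide. *)
Lemma act_local n (s : seq T) :
  act [seq (n, t) | t <- s] (tens [::]) = cf_V (locact s (vxi (X n))) [::].
Proof.
elim: s => [|t s IH] /=.
  rewrite /cf_V vpsi_xi scale1r /deg0 vpsi_xi scale1r subrr.
  by rewrite (tens0 [::]) addr0.
rewrite IH /op /=; case: (side t); first by rewrite lambda_V.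
exact: (@rho_W _ _ _ n (tau n t) _ [::]).
Qed.

Lemma Theta_local n (s : seq T) :
  Theta (act [seq (n, t) | t <- s] (tens [::])) = theta n (locact s (vxi (X n))).
Proof.
rewrite act_local /cf_V linearP /= Theta_xi mulr1 ThetaE; last first.
  by rewrite /reduced /= vpsi_deg0 eqxx.
by rewrite big_seq1 /= /deg0 linearB linearZ /= theta_xi mulr1 addrC subrK.
Qed.

Definition labels w : seq nat := map tag w.

Lemma mem_put s y x w : (y \in put s x w) = (y == x) || (y \in w).
Proof. by rewrite /put; case: s; rewrite ?mem_rcons inE. Qed.

Lemma labels_put s n (x : X n) w : labels (put s (lett x) w) =
  if s then n :: labels w else rcons (labels w) n.
Proof. by rewrite /labels /put; case: s; rewrite ?map_rcons. Qed.

Lemma mem_labels_put s n (x : X n) w m :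
  (m \in labels (put s (lett x) w)) = (m == n) || (m \in labels w).
Proof. by rewrite labels_put; case: s; rewrite ?mem_rcons inE. Qed.

Lemma Theta_actP u a v v' :
  Theta (act u (a *: v + v')) = a * Theta (act u v) + Theta (act u v').
Proof. by rewrite (linearP (act u)) (linearP Theta). Qed.

(* A letter whose label no longer occurs among the operators stays in every
   tensor that is produced. *)
Lemma act_kill u n (x : X n) w : theta n x = 0 -> n \notin map fst u ->
  reduced w -> lett x \in w -> Theta (act u (tens w)) = 0.
Proof.
move=> x0; elim/last_ind: u w => [|u [m t] IH] w.
  move=> _ rw xw; rewrite /= ThetaE //; apply/eqP; rewrite prodf_seq_eq0.
  by apply/hasP; exists (lett x) => //=; rewrite x0.
rewrite map_rcons mem_rcons inE negb_or /= => /andP[nm nu] rw xw.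
rewrite act_rcons; have [fe|[y [v wE]]] := endP (side t) m w.
  rewrite op_out // Theta_actP !IH ?mulr0 ?addr0 //.
    by rewrite reduced_put ?vpsi_deg0 // fe.
  by rewrite mem_put xw orbT.
have y0 : vpsi y = 0 by apply: (@reduced_put_vpsi (side t) m y v); rewrite -wE.
move: rw; rewrite wE => rw; rewrite op_in //.
move: rw xw; rewrite wE reduced_put // => /andP[fe rv].
rewrite mem_put => /orP[/eqP xy|xv]; first by move/(congr1 tag): xy nm => /= ->;
  rewrite eqxx.
rewrite Theta_actP !IH ?mulr0 ?addr0 //.
  by rewrite reduced_put ?vpsi_deg0 // fe.
by rewrite mem_put xv orbT.
Qed.

Lemma free_end_notin s n w : n \notin labels w -> free_end s n w.
Proof.
rewrite /free_end /labels => h; case: s; first by case: w h => //= y w;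
  rewrite inE negb_or eq_sym => /andP[].
by rewrite -mem_rev -map_rev in h; case: (rev w) h => //= y v;
  rewrite inE negb_or eq_sym => /andP[].
Qed.

(** The operators of [u2] act first and carry other labels, so the one labelled [n] finds no letter
    of its own. It appends a letter on which [theta] vanishes, and [act_kill] applies. *)
Lemma act_single u1 n t u2 w :
  vpsi (tau n t (vxi _)) = 0 -> theta n (tau n t (vxi _)) = 0 ->
  n \notin map fst u1 -> n \notin map fst u2 -> reduced w -> n \notin labels w ->
  Theta (act (u1 ++ (n, t) :: u2) (tens w)) = 0.
Proof.
move=> p0 t0 n1; rewrite act_cat /=; elim/last_ind: u2 w => [|u [m t'] IH] w.
  move=> _ rw nw /=; rewrite op_out ?free_end_notin // Theta_actP p0 mul0r add0r
    deg0_id //.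
  apply: act_kill t0 n1 _ _; last by rewrite mem_put eqxx.
  by rewrite reduced_put // free_end_notin.
rewrite map_rcons mem_rcons inE negb_or /= => /andP[nm nu] rw nw.
have lin a v v' : Theta (act u1 (op (n, t) (act u (a *: v + v')))) =
   a * Theta (act u1 (op (n, t) (act u v))) + Theta (act u1 (op (n, t) (act u v'))).
  by rewrite (linearP (act u)) (linearP (op (n, t))) Theta_actP.
rewrite act_rcons; have [fe|[y [v wE]]] := endP (side t') m w.
  rewrite op_out // lin !IH ?mulr0 ?addr0 //.
    by rewrite reduced_put ?vpsi_deg0 // fe.
  by rewrite mem_labels_put negb_or nm.
have y0 : vpsi y = 0 by apply: (@reduced_put_vpsi (side t') m y v); rewrite -wE.
move: rw; rewrite wE => rw; rewrite op_in //.
move: rw nw; rewrite wE reduced_put // mem_labels_put negb_or => /andP[fe rv] /andP[_ nv].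
rewrite lin !IH ?mulr0 ?addr0 //.
  by rewrite reduced_put ?vpsi_deg0 // fe.
by rewrite mem_labels_put negb_or nm.
Qed.

(** * Words of operators in which labels come in pairs *)

Section Pairs.
Hypothesis tau_vpsi : forall n t, vpsi (tau n t (vxi _)) = 0.
Hypothesis tau_theta : forall n t, theta n (tau n t (vxi _)) = 0.
Variables (N : nat) (cpsi ctheta : nat -> F).

Definition left_labels u : seq nat := [seq c.1 | c <- u & side c.2].
Definition right_labels u : seq nat := [seq c.1 | c <- u & ~~ side c.2].
(** Operators are applied from the end of [u]. In this order the next left operator stands just
    before the tensor and the next right operator just after it, each next to the letter it
    meets. *)
Definition chi_word u w := left_labels u ++ labels w ++ rev (right_labels u).
Definition letters n u := [seq c.2 | c <- u & c.1 == n].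

Lemma mem_left_right u n : (n \in map fst u) = (n \in left_labels u) || (n \in
  right_labels u).
Proof.
rewrite /left_labels /right_labels; elim: u => //= c u IH; rewrite inE IH.
by case: side; rewrite /= inE; [rewrite orbA|rewrite orbCA].
Qed.

Lemma count_chi_word u w n :
  count_mem n (chi_word u w) = (count_mem n (map fst u) + count_mem n (labels w))%N.
Proof.
rewrite /chi_word !count_cat count_rev addnA addnAC; congr (_ + _)%N.
rewrite /left_labels /right_labels; elim: u => //= c u <-.
by case: side; rewrite /=; [rewrite addnA|rewrite addnCA].
Qed.

Lemma chi_word_rcons u n t w : chi_word (rcons u (n, t)) w =
  left_labels u ++ (if side t then n :: labels w else rcons (labels w) n)
   ++ rev (right_labels u).
Proof.
rewrite /chi_word /left_labels /right_labels !filter_rcons /=.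
by case: side; rewrite /= ?map_rcons ?rev_rcons ?cat_rcons.
Qed.

Lemma letters_rcons n u m t :
  letters n (rcons u (m, t)) = if m == n then rcons (letters n u) t else letters n u.
Proof. by rewrite /letters filter_rcons /=; case: ifP; rewrite ?map_rcons. Qed.

Lemma letters_notin n u : n \notin map fst u -> letters n u = [::].
Proof.
by rewrite /letters; elim: u => //= c u IH; rewrite inE negb_or eq_sym => /andP[/negPf->].
Qed.

Lemma locact_rcons n s t (x : X n) : locact (rcons s t) x = locact s (tau n t x).
Proof. by rewrite /locact foldr_rcons. Qed.

(** The four states of a label are: absent, closed pair kept in the tensor, one operator applied and
    one to come, both operators to come. *)
Definition balanced u w := forall n,
  (count_mem n (map fst u), count_mem n (labels w)) \in
    [:: (0, 0); (0, 1); (1, 1); (2, 0)]%N.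

(** The last three hypotheses follow a pair through the induction. Untouched, its constants are
    moments of its two operators at [xi]; half applied, they are values of the remaining operator at
    the waiting letter; closed, the letter left behind has [theta]-value [ctheta - cpsi]. *)
Lemma act_pairs u w : reduced w -> all (fun n => n < N)%N (chi_word u w) ->
  balanced u w ->
  (forall n, count_mem n (map fst u) = 2%N ->
     cpsi n = vpsi (locact (letters n u) (vxi (X n))) /\
     ctheta n = theta n (locact (letters n u) (vxi (X n)))) ->
  (forall y, y \in w -> tag y \in map fst u ->
     cpsi (tag y) = vpsi (locact (letters (tag y) u) (tagged y)) /\
     ctheta (tag y) = theta (tag y) (locact (letters (tag y) u) (tagged y))) ->
  (forall y, y \in w -> tag y \notin map fst u ->
     theta (tag y) (tagged y) = ctheta (tag y) - cpsi (tag y)) ->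
  Theta (act u (tens w)) = weight cpsi ctheta N (chi_word u w).
Proof.
elim/last_ind: u w => [|u [n t] IH] w rw aN bal h2 h1 h0.
  rewrite /= ThetaE // weight_uniq //; last first.
    by apply: count1_uniq => n; rewrite count_chi_word /=; have := bal n;
      rewrite /= !inE => /or4P[] /eqP[] // ->.
  by rewrite /chi_word /= cats0 /labels big_map; apply: eq_big_seq => y yw; exact: h0.
have nN : (n < N)%N by apply: (allP aN); rewrite chi_word_rcons; case: side;
  rewrite !mem_cat ?mem_rcons inE eqxx /= ?orbT.
have cu m : count_mem m (map fst (rcons u (n,
  t))) = ((n == m) + count_mem m (map fst u))%N.
  by rewrite map_rcons -cats1 count_cat /= addn0 addnC.
have xi0 : vpsi (tau n t (vxi _)) = 0 := tau_vpsi n t.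
have aN' w' : {subset labels w' <= n :: labels w} -> all (fun m =>
  (m < N)%N) (chi_word u w').
  move=> sw; apply/allP => m; rewrite /chi_word !mem_cat mem_rev => hm.
  apply: (allP aN); rewrite chi_word_rcons !mem_cat mem_rev.
  case/or3P: hm => [->//|/sw|->]; last by rewrite !orbT.
  by case: side; rewrite ?mem_rcons => ->; rewrite orbT.
have [cn|cn] : (count_mem n (map fst u) = 1%N /\ count_mem n (labels w) = 0%N) \/
   (count_mem n (map fst u) = 0%N /\ count_mem n (labels w) = 1%N).
- by have := bal n; rewrite cu eqxx add1n !inE => /or4P[] /eqP[] // -> ->; [right|left].
(* First operator of its pair: as the image of [xi] is centred, it merely becomes a letter, and the
   word of labels does not change. *)
- have [cnu cnw] := cn; have nw : n \notin labels w by apply/count_memPn.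
  have nu : n \in map fst u by rewrite -has_pred1 has_count cnu.
  rewrite act_rcons op_out ?free_end_notin // Theta_actP xi0 mul0r add0r deg0_id //.
  have -> : chi_word (rcons u (n,
    t)) w = chi_word u (put (side t) (lett (tau n t (vxi _))) w).
    by rewrite chi_word_rcons /chi_word labels_put.
  have clp m : count_mem m (labels (put (side t) (lett (tau n t (vxi _))) w)) =
      ((n == m) + count_mem m (labels w))%N.
    by rewrite labels_put; case: side; rewrite //= -cats1 count_cat /= addn0 addnC.
  apply: IH.
  + by rewrite reduced_put // free_end_notin.
  + by apply: aN' => m; rewrite mem_labels_put inE.
  + move=> m; rewrite clp; have := bal m; rewrite cu; case: (eqVneq n m) => [<-|_] //.
    by rewrite cnu cnw.
  + move=> m cm; have nm : n == m = false by apply/negP => /eqP nm; rewrite -nm cnu in cm.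
    by have := h2 m; rewrite cu nm letters_rcons nm; apply.
  + move=> y; rewrite mem_put => /orP[/eqP->|yw] /= yu.
      by have := h2 n; rewrite cu eqxx cnu letters_rcons eqxx locact_rcons; apply.
    have ny : n == tag y = false by apply/negP => /eqP ny; rewrite ny map_f in nw.
    by have := h1 y yw; rewrite map_rcons mem_rcons inE yu orbT letters_rcons ny; apply.
  move=> y; rewrite mem_put => /orP[/eqP->|yw] /= yu; first by rewrite nu in yu.
  have ny : n == tag y = false by apply/negP => /eqP ny; rewrite ny map_f in nw.
  by apply: h0; rewrite // map_rcons mem_rcons inE negb_or eq_sym ny.
have [cnu cnw] := cn; have nu : n \notin map fst u by apply/count_memPn.
have nw : n \in labels w by rewrite -has_pred1 has_count cnw.
rewrite act_rcons; have [fe|[x [v wE]]] := endP (side t) n w.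
  (* The partner lies deeper in the tensor. The appended letter is never touched again and has
     [theta]-value [0], so the left side vanishes; the weight vanishes because another letter [k]
     blocks the way. *)
  rewrite op_out // Theta_actP xi0 mul0r add0r deg0_id //.
  rewrite (@act_kill u n (tau n t (vxi _))) // ?reduced_put ?fe ?mem_put ?eqxx //.
  have [k [V [nk [kw wE nV]]]] : exists k V, n != k /\ [/\ k \in labels w,
     labels w = (if side t then k :: V else rcons V k) & n \in V].
    move: fe nw; rewrite /free_end /labels; case: side.
      case: w {rw aN bal h2 h1 h0 aN' cn cnw} => //= y w yn.
      rewrite inE eq_sym (negPf yn) => nw; exists (tag y), (map tag w).
      by rewrite inE eqxx eq_sym.
    case/lastP: w {rw aN bal h2 h1 h0 aN' cn cnw} => //= w y.
    rewrite rev_rcons map_rcons mem_rcons inE => yn; rewrite eq_sym (negPf yn) => nw.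
    by exists (tag y), (map tag w); rewrite mem_rcons inE eqxx eq_sym.
  symmetry; apply: (@weight_blocked _ cpsi ctheta N _ (left_labels u)
     (if side t then n :: labels w else rcons (labels w) n) V (rev (right_labels u)) n
       k) => //.
  + apply: (allP aN); rewrite chi_word_rcons; case: side;
    by rewrite !mem_cat ?mem_rcons inE kw /= !orbT.
  + by rewrite chi_word_rcons.
  + by rewrite wE; case: side; [left|right].
  have := bal k; rewrite count_chi_word cu (negPf nk) add0n mem_rev.
  move: kw; rewrite -has_pred1 has_count.
  rewrite !inE => k0 /or4P[] /eqP[e1 e2]; rewrite ?e2 // in k0 *.
    by apply: Or33; rewrite e1.
  have : k \in map fst u by rewrite -has_pred1 has_count e1.
  by rewrite mem_left_right => /orP[]; [apply: Or31|apply: Or32].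
(* The operator meets its partner. The scalar part removes the letter and the centred part keeps a
   closed one, which are the two terms of [weight_pair]. *)
have x0 : vpsi x = 0 by apply: (@reduced_put_vpsi (side t) n x v); rewrite -wE.
move: rw; rewrite wE => rw; rewrite op_in // Theta_actP.
move: (rw); rewrite reduced_put // => /andP[fe rv].
have nv : n \notin labels v.
  move: cnw; rewrite wE labels_put => h; apply/count_memPn.
  by case: side h; rewrite /= ?eqxx -?cats1 ?count_cat /= ?eqxx ?addn0 ?addn1 => -[].
have [] := h1 (lett x); rewrite ?wE ?mem_put ?eqxx //= ?map_rcons ?mem_rcons ?inE ?eqxx
  //.
rewrite letters_rcons eqxx letters_notin //= => cpE ctE.
have clw m : count_mem m (labels w) = ((n == m) + count_mem m (labels v))%N.
  by rewrite wE labels_put; case: side; rewrite //= -cats1 count_cat /= addn0 addnC.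
have vw y : y \in v -> y \in w by rewrite wE mem_put orbC => ->.
have H2 m : count_mem m (map fst u) = 2%N ->
     cpsi m = vpsi (locact (letters m u) (vxi (X m))) /\
     ctheta m = theta m (locact (letters m u) (vxi (X m))).
  move=> cm; have nm : n == m = false by apply/negP => /eqP nm; rewrite -nm cnu in cm.
  by have := h2 m; rewrite cu nm letters_rcons nm; apply.
have H1 y : y \in v -> tag y \in map fst u ->
     cpsi (tag y) = vpsi (locact (letters (tag y) u) (tagged y)) /\
     ctheta (tag y) = theta (tag y) (locact (letters (tag y) u) (tagged y)).
  move=> yv yu; have ny : n == tag y = false by apply/negP => /eqP ny;
    rewrite ny yu in nu.
  by have := h1 y (vw _ yv); rewrite map_rcons mem_rcons inE yu orbT letters_rcons ny;
    apply.
have H0 y : y \in v -> tag y \notin map fst u ->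
     theta (tag y) (tagged y) = ctheta (tag y) - cpsi (tag y).
  move=> yv yu; have ny : n == tag y = false by apply/negP => /eqP ny;
    rewrite ny map_f in nv.
  by apply: h0; rewrite ?vw // map_rcons mem_rcons inE negb_or eq_sym ny.
rewrite (IH v) //; first last.
- move=> m; have := bal m; rewrite cu clw; case: (eqVneq n m) => [<-|_] // _.
  by rewrite cnu (count_memPn nv).
- by apply: aN' => m mv; rewrite wE inE mem_labels_put mv !orbT.
rewrite (IH (put (side t) (lett (deg0 (tau n t x))) v)) //; first last.
(* The new closed letter is the centred part of a vector with [vpsi]-value [cpsi] and [theta]-value
   [ctheta], hence the difference. *)
- move=> y; rewrite mem_put => /orP[/eqP->|yv] /= yu; last exact: H0.
  by rewrite /deg0 linearB linearZ /= theta_xi mulr1 cpE ctE.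
- move=> y; rewrite mem_put => /orP[/eqP->|yv] /= yu; last exact: H1.
  by rewrite yu in nu.
- move=> m; have := bal m; rewrite cu clw !labels_put.
  have -> : count_mem m (if side t then n :: labels v else rcons (labels v) n) =
     ((n == m) + count_mem m (labels v))%N.
    by case: side; rewrite //= -cats1 count_cat /= addn0 addnC.
  by case: (eqVneq n m) => [<-|_] // _; rewrite cnu (count_memPn nv).
- by apply: aN' => m; rewrite mem_labels_put inE wE mem_labels_put => /orP[->//|->];
  rewrite !orbT.
- by rewrite reduced_put ?vpsi_deg0 // fe.
rewrite -cpE chi_word_rcons /chi_word !labels_put.
have nL : n \notin left_labels u by move: nu; rewrite mem_left_right negb_or => /andP[].
have nR : n \notin rev (right_labels u).
  by rewrite mem_rev; move: nu; rewrite mem_left_right negb_or => /andP[].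
case: side.
  by rewrite /= weight_pair // mem_cat negb_or nv.
rewrite !cat_rcons !catA weight_pair //.
by rewrite mem_cat negb_or nL.
Qed.

End Pairs.
End Words.

(** * Bounds uniform in the labels *)

Section BoundedWords.
Variables (F : numFieldType) (X : nat -> tsvs F).
Variables (T : Type) (side : T -> bool) (tau : forall n, T -> {linear X n -> X n}).
Variables (theta : forall n, {scalar X n}) (Theta : {scalar (cfree_product X)}).
Hypothesis theta_xi : forall n, theta n (vxi _) = 1.
Hypothesis ThetaE : forall w, reduced w ->
  Theta (tens w) = \prod_(y <- w) theta (tag y) (tagged y).
Hypothesis moment_bound : forall s : seq T, exists M : F, forall n,
  `|vpsi (locact tau s (vxi (X n)))| <= M /\ `|theta n (locact tau s (vxi (X n)))| <= M.

(** Recording a letter by its label and the operators that produced it separates the label, over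
    which the bound is uniform, from the data on which the bound may depend. *)
Definition local_letter (p : nat * seq T) : {n & X n} :=
  lett (deg0 (locact tau p.2 (vxi (X p.1)))).

Lemma normP_bound (a x y A B C : F) : `|a| <= A -> `|x| <= B -> `|y| <= C ->
  `|a * x + y| <= A * B + C.
Proof.
move=> ha hx hy; apply: le_trans (ler_normD _ _) _; rewrite normrM.
by rewrite lerD // ler_pM.
Qed.

Lemma tens_put s n (a : F) (x y : X n) w : vpsi x = 0 -> vpsi y = 0 ->
  tens (put s (lett (a *: x + y)) w) =
  a *: tens (put s (lett x) w) + tens (put s (lett y) w).
Proof.
move=> x0 y0; rewrite /put; case: s; first exact: (tens_multilin [::]).
by rewrite -!cats1 tens_multilin.
Qed.

(** Applying one operator leads to finitely many tensors with the same kind of letters, with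
    coefficients that are moments of a single family. Both the shapes of these tensors and the
    bounds for the coefficients are independent of the labels. *)
Lemma act_bounded ts Ws : exists M : F, forall u v, map snd u = ts -> map snd v = Ws ->
  reduced (map local_letter v) ->
  `|Theta (act side tau u (tens (map local_letter v)))| <= M.
Proof.
elim/last_ind: ts Ws => [|ts t IH] Ws.
  have [M hM] : exists M : F, forall v, map snd v = Ws ->
     `|\prod_(y <- map local_letter v) theta (tag y) (tagged y)| <= M.
    elim: Ws => [|W Ws [M hM]]; first by exists 1; case => // _; rewrite big_nil normr1.
    have [B hB] := moment_bound W.
    exists ((B * 1 + B) * M); case=> // -[n W'] v [-> /hM hv].
    rewrite big_cons normrM ler_pM //= linearB linearZ /= theta_xi mulr1 addrC.
    have [h1 h2] := hB n; rewrite -[vpsi _]mulr1 -mulNr.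
    by apply: normP_bound; rewrite ?normrN ?normr1.
  by exists M; case=> // v _ vW rv; rewrite /= ThetaE //; apply: hM.
have [A hA] := moment_bound [:: t].
have [B hB] := IH Ws; have [C hC] := IH (put (side t) [:: t] Ws).
have out n u v : map snd u = ts -> map snd v = Ws -> reduced (map local_letter v) ->
    free_end (side t) n (map local_letter v) ->
    `|Theta (act side tau (rcons u (n, t)) (tens (map local_letter v)))| <= A * B + C.
  move=> us vs rv fe; rewrite act_rcons op_out // Theta_actP.
  have [hAn _] := hA n; apply: normP_bound => //; first exact: hB.
  rewrite -[lett _]/(local_letter (n, [:: t])) -map_put; apply: hC => //.
    by rewrite map_put vs.
  by rewrite map_put reduced_put ?vpsi_deg0 // fe.
have [W0|[W [Ws' WE]]] := putP (side t) Ws.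
  exists (A * B + C) => u v; case/lastP: u => [|u [n t']];
    first by case: ts {IH hB hC out}.
  rewrite map_rcons => /rcons_inj[us ->] vs rv; apply: out => //.
  by move: vs; rewrite W0; case: v {rv} => //= _; case: side.
have [D hD] := moment_bound W; have [D' hD'] := moment_bound (t :: W).
have [E hE] := IH Ws'; have [G hG] := IH (put (side t) [:: t] Ws').
have [H hH] := IH (put (side t) (t :: W) Ws').
pose bin := (D * A + D') * E + (D * G + H).
have le_abs (x M M' : F) : `|x| <= M -> `|x| <= `|M| + `|M'|.
  by move=> h; rewrite (ger0_norm (le_trans (normr_ge0 _) h)) (le_trans h) // lerDl.
(* Whether the operator meets its own label depends on the labels, so one bound must serve both
   cases; a sum of norms is used because the two bounds need not be comparable. *)
exists (`|A * B + C| + `|bin|) => u v.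
case/lastP: u => [|u [n t']]; first by case: ts {IH hB hC out hE hG hH}.
rewrite map_rcons => /rcons_inj[us ->] vs rv.
have [fe|fe] := boolP (free_end (side t) n (map local_letter v)).
  by apply: le_abs; apply: out.
rewrite addrC; apply: le_abs.
have [v0|[[m W''] [v' vE]]] := putP (side t) v; first by case/negP: fe; rewrite v0;
  case: side.
move: vs; rewrite vE map_put WE => /(@put_inj (seq T)) [/= WW vs']; subst W'' v.
have nm : m = n.
  move: fe; rewrite map_put /free_end /put; case: (side t); rewrite /= ?rev_rcons /=;
  by rewrite negbK => /eqP.
subst m; move: rv; rewrite map_put => rv; rewrite act_rcons op_in // Theta_actP.
move: (rv); rewrite reduced_put ?vpsi_deg0 // => /andP[fe' rv'].
(* The centring is expanded so that both vectors are again local operator words applied to [xi]. *)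
have -> : tau n t (deg0 (locact tau W (vxi (X n)))) =
    - vpsi (locact tau W (vxi (X n))) *: locact tau [:: t] (vxi (X n))
    + locact tau (t :: W) (vxi (X n)).
  by rewrite /deg0 linearB linearZ /= scaleNr addrC.
have [hA1 _] := hA n; have [hD1 _] := hD n; have [hD1' _] := hD' n.
rewrite linearP deg0_linear tens_put ?vpsi_deg0 // Theta_actP.
apply: normP_bound; [apply: normP_bound => //; by rewrite normrN | exact: hE |].
apply: normP_bound; first by rewrite normrN.
  rewrite -[lett _]/(local_letter (n, [:: t])) -map_put; apply: hG => //.
    by rewrite map_put vs'.
  by rewrite map_put reduced_put ?vpsi_deg0 ?fe'.
rewrite -[lett _]/(local_letter (n, t :: W)) -map_put; apply: hH => //.
  by rewrite map_put vs'.
by rewrite map_put reduced_put ?vpsi_deg0 ?fe'.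
Qed.

End BoundedWords.

(** * Bi-non-crossing partitions *)

Section ChiOrder.
Variables (d : nat) (chi : 'I_d -> bool).
Implicit Types (i j k : 'I_d).
Notation lt := (chi_lt chi).

Lemma chi_lt_irr : irreflexive lt.
Proof. by move=> i; rewrite /chi_lt; case: chi; rewrite ltnn. Qed.

Lemma chi_lt_trans : transitive lt.
Proof.
move=> j i k; rewrite /chi_lt; case: (chi i); case: (chi j); case: (chi k) => //.
  exact: ltn_trans.
by move=> h1 h2; apply: ltn_trans h2 h1.
Qed.

Lemma chi_lt_total i j : i != j -> lt i j || lt j i.
Proof.
by rewrite /chi_lt -val_eqE neq_ltn /=; case: (chi i); case: (chi j); rewrite // orbC.
Qed.

Lemma chi_lt_neq i j : lt i j -> i != j.
Proof. by apply: contraTneq => ->; rewrite chi_lt_irr. Qed.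

Definition chi_enum : seq 'I_d :=
  [seq i <- enum 'I_d | chi i] ++ rev [seq i <- enum 'I_d | ~~ chi i].

Lemma mem_chi_enum i : i \in chi_enum.
Proof. have iE : i \in enum 'I_d by rewrite mem_enum.
by rewrite mem_cat mem_rev (mem_filter chi) (mem_filter (predC chi)) iE /= andbT;
  case: chi.
Qed.

Lemma chi_enum_sorted : sorted lt chi_enum.
Proof.
have s0 : pairwise (fun i j : 'I_d => i < j)%N (enum 'I_d).
  rewrite -(@pairwise_map _ _ val ltn) val_enum_ord -sorted_pairwise ?iota_ltn_sorted //.
  exact: ltn_trans.
rewrite sorted_pairwise; last exact: chi_lt_trans.
rewrite /chi_enum pairwise_cat; apply/and3P; split.
- apply/allrelP => i j; rewrite (mem_filter chi) mem_rev (mem_filter (predC chi)) /=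
  /chi_lt => /andP[-> _] /andP[].
  by case: chi.
- apply: (sub_in_pairwise (P := chi) (r := fun i j : 'I_d => i < j)%N).
  + by move=> i j ci cj; rewrite /chi_lt (ci : chi i) (cj : chi j).
  + exact: filter_all.
  exact: pairwise_filter.
rewrite -sorted_pairwise ?rev_sorted ?sorted_pairwise;
  [|exact: rev_trans chi_lt_trans|exact: chi_lt_trans].
apply: (sub_in_pairwise (P := predC chi) (r := fun i j : 'I_d => i < j)%N).
- by move=> i j ci cj; rewrite /chi_lt (negPf (ci : ~~ chi i)) (negPf (cj : ~~ chi j)).
- exact: filter_all.
exact: pairwise_filter.
Qed.

(** A list sorted for [lt] is determined by its set of elements, so it is the enumeration filtered
    by that set. *)
Lemma subseq_chi_enum s : subseq s chi_enum = sorted lt s.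
Proof.
apply/idP/idP => [h|ss]; first exact: (subseq_sorted chi_lt_trans h chi_enum_sorted).
have -> : s = [seq i <- chi_enum | i \in s].
  apply: (irr_sorted_eq chi_lt_trans chi_lt_irr) => //.
    exact: (subseq_sorted chi_lt_trans (filter_subseq _ _) chi_enum_sorted).
  by move=> i; rewrite mem_filter mem_chi_enum andbT.
exact: filter_subseq.
Qed.

Lemma subseq_map_chi (L : eqType) (f : 'I_d -> L) (s : seq L) :
  subseq s (map f chi_enum) <-> exists2 t, sorted lt t & s = map f t.
Proof.
split=> [/subseqP[m sm ->]|[t st ->]].
  exists (mask m chi_enum); last by rewrite map_mask.
  by rewrite -subseq_chi_enum mask_subseq.
by apply: map_subseq; rewrite subseq_chi_enum.
Qed.

(** * Kernels of labellings *)

Section Kernel.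
Variables (N : nat) (f : 'I_d -> 'I_N).

Definition fiber (n : 'I_N) : {set 'I_d} := [set j | f j == n].
Definition kernel : {set {set 'I_d}} := [set fiber n | n in f @: [set: 'I_d]].

Lemma mem_fiber i : i \in fiber (f i). Proof. by rewrite inE. Qed.

Lemma fiber_kernel i : fiber (f i) \in kernel.
Proof. by rewrite imset_f // imset_f. Qed.

Lemma kernelP V : reflect (exists i, V = fiber (f i)) (V \in kernel).
Proof.
apply: (iffP imsetP) => [[n /imsetP[i _ ->] ->]|[i ->]]; first by exists i.
by exists (f i); rewrite ?imset_f.
Qed.

Lemma fiber_inj : {in f @: [set: 'I_d] &, injective fiber}.
Proof.
by move=> n m /imsetP[i _ ->] _ /setP/(_ i); rewrite !inE eqxx => /esym/eqP.
Qed.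

Lemma kernel_partition : finset.partition kernel [set: 'I_d].
Proof.
apply/and3P; split.
- apply/eqP/setP => i; rewrite inE; apply/bigcupP.
  by exists (fiber (f i)); rewrite ?fiber_kernel ?mem_fiber.
- apply/trivIsetP => V W /kernelP[i ->] /kernelP[j ->].
  apply: contraR => /pred0Pn[k /andP[]]; rewrite !inE => /eqP <- /eqP <-.
  by [].
by apply/kernelP => -[i /setP/(_ i)]; rewrite !inE eqxx.
Qed.

Lemma kernel_constant V i j : V \in kernel -> i \in V -> j \in V -> f i = f j.
Proof. by case/kernelP => k ->; rewrite !inE => /eqP -> /eqP ->. Qed.

Hypothesis card2 : forall i, #|fiber (f i)| = 2%N.

Lemma fiber2 i j k : f j = f i -> f k = f i -> i != j -> (k == i) || (k == j).
Proof.
move=> ji ki ij; have /eqP e : [set i; j] == fiber (f i).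
  rewrite eqEcard cards2 ij card2 andbT.
  by apply/subsetP => x; rewrite !inE => /orP[] /eqP ->; rewrite ?ji.
have : k \in fiber (f i) by rewrite inE ki.
by rewrite -e !inE.
Qed.

Let Z : seq nat := [seq val (f i) | i <- chi_enum].

Lemma crossing_kernel : crossing Z = ~~ noncrossing chi kernel.
Proof.
apply/crossingP/idP => [[a [b [ab]]]|].
  case/subseq_map_chi => -[|i [|k [|j [|l []]]]] //= /and4P[ik kj jl _] [ai bk aj bl].
  apply/negP => /forall_inP/(_ _ (fiber_kernel i))/forall_inP/(_ _ (fiber_kernel k)).
  have -> /= : fiber (f i) != fiber (f k).
    apply: contraNneq ab => /(fiber_inj (imset_f _ (in_setT _)) (imset_f _ (in_setT _))).
    by rewrite ai bk => ->.
  case/negP; apply/exists_inP; exists i; first exact: mem_fiber.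
  apply/exists_inP; exists k; first exact: mem_fiber.
  apply/exists_inP; exists j; first by rewrite inE -val_eqE /= -ai aj.
  by apply/exists_inP; exists l; rewrite ?ik ?kj ?jl // inE -val_eqE /= -bk bl.
rewrite negb_forall_in => /exists_inP[V VP]; rewrite negb_forall_in => /exists_inP[W WP].
rewrite negb_imply negbK => /andP[VW /exists_inP[i iV /exists_inP[k kW /exists_inP[j
  jV]]]].
case/exists_inP => l lW /and3P[ik kj jl].
exists (val (f i)), (val (f k)); split.
  apply: contraNneq VW => /val_inj e.
  case/kernelP: VP iV => i0 ->; case/kernelP: WP kW => k0 ->; rewrite !inE.
  by move=> /eqP <- /eqP <-; rewrite e.
apply/subseq_map_chi; exists [:: i; k; j; l]; first by rewrite /= ik kj jl.
by rewrite /= (kernel_constant VP jV iV) (kernel_constant WP lW kW).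
Qed.

(** A covering puts just one position of the block under an arc, while [interior] compares the
    extremes of both blocks. Since fibres have two elements, it remains to see that the other
    position is under the arc too, as otherwise the two blocks would cross. *)
Lemma covered_kernel i : noncrossing chi kernel ->
  covered (val (f i)) Z = interior chi kernel (fiber (f i)).
Proof.
move=> nc; apply/coveredP/idP => [[m [mi]]|].
  case/subseq_map_chi => -[|w [|v [|w' []]]] //= /and3P[wv vw' _] [mw iv mw'].
  have ww' : w != w' by apply: chi_lt_neq; apply: chi_lt_trans wv vw'.
  have fww : f w' = f w by apply: val_inj; rewrite /= -mw.
  have fiv : f v = f i by apply: val_inj.
  have nmi : f w != f i by rewrite -val_eqE /= -mw.
  have : (1 < #|fiber (f i)|)%N by rewrite card2.
  case/card_gt1P => x [y [xi yi xy]].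
  have [v' vv' fv'] : exists2 v', v != v' & f v' = f i.
    rewrite !inE in xi yi; have [vx|vx] := eqVneq v x; last by exists x => //; apply/eqP.
    by exists y; [rewrite vx|apply/eqP].
  have fwv' : w != v' by apply: contraNneq nmi => ->; rewrite fv'.
  have fwv'' : w' != v' by apply: contraNneq nmi => e; rewrite -fww e fv'.
  have ncr j1 j2 j3 j4 : f j1 != f j2 -> f j1 = f j3 -> f j2 = f j4 ->
      lt j1 j2 -> lt j2 j3 -> lt j3 j4 -> False.
    move=> n12 e13 e24 l12 l23 l34.
    suff : crossing Z by rewrite crossing_kernel nc.
    apply/crossingP; exists (val (f j1)), (val (f j2)); split=> //.
    apply/subseq_map_chi; exists [:: j1; j2; j3; j4]; first by rewrite /= l12 l23 l34.
    by rewrite /= -e13 -e24.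
  have wv' : lt w v'.
    case/orP: (chi_lt_total fwv') => // h.
    by case: (@ncr v' w v w'); rewrite ?fv' ?fiv // eq_sym.
  have v'w' : lt v' w'.
    case/orP: (chi_lt_total fwv'') => // h.
    by case: (@ncr w v w' v'); rewrite ?fv' ?fiv.
  apply/exists_inP; exists (fiber (f w)); first exact: fiber_kernel.
  apply/andP; split.
    apply: contraNneq nmi => /(fiber_inj (imset_f _ (in_setT _)) (imset_f _ (in_setT _))).
    by move=> ->.
  have wmin : is_chi_min chi (fiber (f w)) w.
    rewrite /is_chi_min mem_fiber; apply/forall_inP => j; rewrite inE => /eqP jw.
    apply/implyP => nj; move: (fiber2 fww jw ww'); rewrite (negPf nj) => /eqP ->.
    exact: chi_lt_trans wv vw'.
  have w'max : is_chi_max chi (fiber (f w)) w'.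
    rewrite /is_chi_max inE fww eqxx; apply/forall_inP => j; rewrite inE => /eqP jw.
    apply/implyP => nj; move: (fiber2 fww jw ww'); rewrite (negPf nj) orbF => /eqP ->.
    exact: chi_lt_trans wv vw'.
  have vmin a b : f a = f i -> f b = f i -> lt a b -> is_chi_min chi (fiber (f i)) a.
    move=> fa fb ab; rewrite /is_chi_min inE fa eqxx; apply/forall_inP => j.
    rewrite inE => /eqP ja; apply/implyP => nj.
    have := @fiber2 a b j; rewrite fa fb ja chi_lt_neq // => /(_ erefl erefl isT).
    by rewrite (negPf nj) => /eqP ->.
  have vmax a b : f a = f i -> f b = f i -> lt a b -> is_chi_max chi (fiber (f i)) b.
    move=> fa fb ab; rewrite /is_chi_max inE fb eqxx; apply/forall_inP => j.
    rewrite inE => /eqP ja; apply/implyP => nj.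
    have := @fiber2 a b j; rewrite fa fb ja chi_lt_neq // => /(_ erefl erefl isT).
    by rewrite (negPf nj) orbF => /eqP ->.
  case/orP: (chi_lt_total vv') => h; apply/existsP; exists w; apply/existsP.
    exists v; apply/existsP; exists v'; apply/existsP; exists w'.
    by rewrite wmin w'max (vmin v v') // (vmax v v') // wv v'w'.
  exists v'; apply/existsP; exists v; apply/existsP; exists w'.
  by rewrite wmin w'max (vmin v' v) // (vmax v' v) // wv' vw'.
case/exists_inP => W /kernelP[m ->] /andP[Wi].
case/existsP => w1 /existsP[v1 /existsP[v2 /existsP[w2]]].
case/and5P => /andP[w1W _] /andP[v1V /forall_inP v1min] /andP[v2V _] /andP[w2W _]
  /andP[wv vw].
move: w1W w2W v1V v2V; rewrite !inE => /eqP w1W /eqP w2W /eqP v1V /eqP v2V.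
exists (val (f m)); split; first by apply: contraNneq Wi => /val_inj ->.
apply/subseq_map_chi; exists [:: w1; v1; w2]; last by rewrite /= w1W w2W v1V.
rewrite /= wv; have [<-|ne] := eqVneq v2 v1; first by rewrite vw.
have v2i : v2 \in fiber (f i) by rewrite inE v2V.
by rewrite (chi_lt_trans (implyP (v1min v2 v2i) ne) vw).
Qed.

(** Labels that [f] misses have weight [1], so the product over all labels becomes one over the
    blocks of the kernel. *)
Lemma weight_kernel (F : comNzRingType) (cpsi ctheta : nat -> F) (A B : {set 'I_d} -> F) :
  (forall i, cpsi (f i) = A (fiber (f i))) -> (forall i,
    ctheta (f i) = B (fiber (f i))) ->
  weight cpsi ctheta N Z = if kernel \in bnc chi then
     \prod_(V in kernel) (if interior chi kernel V then A V else B V) else 0.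
Proof.
move=> cA cB; rewrite /weight crossing_kernel inE kernel_partition /=.
case: ifP => [/negPf -> //|/negbFE nc]; rewrite nc /kernel (big_imset _ fiber_inj) /=.
rewrite [RHS]big_mkcond /=; apply: eq_bigr => n _; rewrite /wt.
have cnt : count_mem (val n) Z = #|fiber n|.
  have pe : perm_eq chi_enum (enum 'I_d).
    apply: uniq_perm; rewrite ?enum_uniq //; last by move=> i;
      rewrite mem_chi_enum mem_enum.
    exact: (sorted_uniq chi_lt_trans chi_lt_irr chi_enum_sorted).
  rewrite count_map (permP pe) -sum1_count big_enum_cond -sum1_card /=.
  by apply: eq_bigl => i; rewrite !inE.
have [nf|nf] := boolP (n \in f @: [set: 'I_d]).
  have [i _ ni] := imsetP nf.
  rewrite cnt ni card2 covered_kernel // cA cB; case: ifP => //.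
rewrite cnt (_ : fiber n = set0) ?cards0 //.
apply/setP => i; rewrite !inE; apply: contraNF nf => /eqP <-.
by rewrite imset_f.
Qed.

End Kernel.
End ChiOrder.

(** * Cumulants and the Gaussian family *)

Section BncTheory.
Variables (n : nat) (chi : 'I_n -> bool).
Hypothesis n_gt0 : (0 < n)%N.
Notation top := [set [set: 'I_n]]%SET.

Lemma partition_top : finset.partition top [set: 'I_n].
Proof.
apply/and3P; split; first by rewrite /finset.cover big_set1.
  by apply/trivIsetP => V W /set1P -> /set1P ->; rewrite eqxx.
by apply/set1P => /setP/(_ (Ordinal n_gt0)); rewrite !inE.
Qed.

Lemma bnc_top : top \in bnc chi.
Proof.
rewrite inE partition_top; apply/forall_inP => V /set1P ->.
by apply/forall_inP => W /set1P ->; rewrite eqxx.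
Qed.

Lemma interior_neq P V : interior chi P V -> exists2 W, W \in P & W != V.
Proof. by case/exists_inP => W WP /andP[WV _]; exists W. Qed.

Lemma interior_top : interior chi top [set: 'I_n] = false.
Proof. by apply/negbTE/negP => /interior_neq[W /set1P ->]; rewrite eqxx. Qed.

Lemma bnc_block_gt0 P V : P \in bnc chi -> V \in P -> (0 < #|V|)%N.
Proof.
rewrite inE => /andP[/and3P[_ _ P0] _] VP; rewrite card_gt0.
by apply: contraNneq P0 => <-.
Qed.

Lemma bnc_block_lt P V : P \in bnc chi -> P != top -> V \in P -> (#|V| < n)%N.
Proof.
rewrite inE => /andP[/and3P[_ tP P0] _] nP VP.
have Vn : (#|V| <= n)%N by have := max_card (mem V); rewrite card_ord.
rewrite ltn_neqAle Vn andbT; apply: contraNneq nP => cV.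
have VT : V = [set: 'I_n] by apply/eqP; rewrite eqEcard subsetT cardsT card_ord cV leqnn.
apply/eqP; apply/setP => W; rewrite in_set1; apply/idP/idP => [WP|/eqP ->];
  last by rewrite -VT.
rewrite -VT; apply: contraT => WV.
have := trivIsetP tP W V WP VP WV; rewrite VT -setI_eq0 setIT => /eqP W0.
by rewrite -W0 WP in P0.
Qed.

End BncTheory.

(** * Existence of cumulants *)

Section CumulantExistence.
Variables (F : fieldType) (A : ncps2 F).
Implicit Types (s : seq (bool * A)) (K : seq (bool * A) -> F).

Definition sub_word s n (V : {set 'I_n}) := [seq nth (true, 0) s i | i : 'I_n <- enum V].
Definition word_chi s n (i : 'I_n) := (nth (true, 0) s i).1.

Lemma size_sub_word s n (V : {set 'I_n}) : size (sub_word s V) = #|V|.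
Proof. by rewrite size_map cardE. Qed.

Variables (m : {scalar A}) (o : option (seq (bool * A) -> F)).

(* [o = None] solves the moment-cumulant equations with the same functional on
   all blocks; [o = Some kappa] prescribes [kappa] on the interior blocks. *)
Definition block_val K (b : bool) s := if b then odflt K o s else K s.

Definition lower_terms K s n :=
  \sum_(P in bnc (word_chi s (n := n)) | P != [set [set: 'I_n]]%SET)
     \prod_(V in P) block_val K (interior (word_chi s (n := n)) P V) (sub_word s V).

(** The partition with one block contributes the cumulant of the whole word, and the blocks of all
    others are shorter. The moment formula is thus solved by recursion on the length, which the fuel
    bounds. *)
Fixpoint cum_rec fuel s : F :=
  if fuel is k.+1 then m (\prod_(x <- s) x.2) - lower_terms (cum_rec k) s (size s) else 0.

Definition cum s := cum_rec (size s) s.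

Lemma eq_lower_terms K K' s n : (0 < n)%N ->
  (forall t, (0 < size t < n)%N -> K t = K' t) -> lower_terms K s n = lower_terms K' s n.
Proof.
move=> n0 KE; apply: eq_bigr => P /andP[PB PT]; apply: eq_bigr => V VP.
have e : K (sub_word s V) = K' (sub_word s V).
  by apply: KE; rewrite size_sub_word (bnc_block_gt0 PB VP) (bnc_block_lt PB PT VP).
by rewrite /block_val; case: interior; case: o => /=.
Qed.

Lemma cum_rec_stable k k' s : (0 < size s)%N -> (size s <= k)%N -> (size s <= k')%N ->
  cum_rec k s = cum_rec k' s.
Proof.
elim: k k' s => [|k IH] [|k'] s s0 //=; rewrite ?leqn0; try by case: (size s) s0.
move=> sk sk'; congr (_ - _); apply: eq_lower_terms => // t /andP[t0 ts].
by apply: IH; rewrite // -ltnS (leq_trans ts).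
Qed.

Lemma cumE s n : (0 < n)%N -> size s = n ->
  cum s = m (\prod_(x <- s) x.2) - lower_terms cum s n.
Proof.
move=> n0 sn; rewrite /cum sn; case: n n0 sn => // n _ sn /=; rewrite sn.
congr (_ - _); apply: eq_lower_terms => // t /andP[t0 tn].
exact: cum_rec_stable.
Qed.

Lemma cum_moment n (chi : 'I_n -> bool) (a : 'I_n -> A) : (0 < n)%N ->
  m (\prod_(i < n) a i) = \sum_(P in bnc chi) \prod_(V in P)
     block_val cum (interior chi P V) (restr chi a V).
Proof.
move=> n0; pose s := [seq (chi i, a i) | i <- enum 'I_n].
have sn : size s = n by rewrite size_map size_enum_ord.
have sE (i : 'I_n) : nth (true, 0) s i = (chi i, a i).
  by rewrite (nth_map i) ?size_enum_ord // nth_ord_enum.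
have chiE : word_chi s (n := n) = chi by apply: funext => i; rewrite /word_chi sE.
have subE (V : {set 'I_n}) : sub_word s V = restr chi a V.
  by apply: eq_map => i; rewrite sE.
have prodE : \prod_(x <- s) x.2 = \prod_(i < n) a i 
  by rewrite /s big_map enumT [index_enum _]unlock.
have := cumE n0 sn; rewrite /lower_terms chiE prodE => cE.
have -> : m (\prod_(i < n) a i) = cum s + (m (\prod_(i < n) a i) - cum s).
  by rewrite addrC subrK.
rewrite (bigD1 [set [set: 'I_n]]%SET) /=; last exact: bnc_top.
rewrite big_set1 interior_top /block_val /=; congr (_ + _).
  by congr cum; rewrite /restr enum_setT -enumT.
rewrite cE opprB addrC subrK; apply: eq_bigr => P _; apply: eq_bigr => V _.
by rewrite subE.
Qed.

Hypothesis o_lin : if o is Some kappa then multilinear kappa else True.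

(** Strong induction on the length. In a partition other than the top one, the varied entry lies in
    exactly one block [V0]; the other factors do not see it, and the factor of [V0] is linear in it
    by induction or by [o_lin]. *)
Lemma cum_multilinear : multilinear cum.
Proof.
move=> s s' c x a b; have [n] := ubnP (size s + size s').+1.
elim: n s s' => // n IH s s'; rewrite ltnS => sn.
pose w y : seq (bool * A) := s ++ (c, y) :: s'.
pose k := (size s + size s').+1.
have wk y : size (w y) = k by rewrite size_cat /= addnS.
have k0 : (0 < k)%N by [].
rewrite -!/(w _) !(cumE k0 (wk _)).
have is_k : (size s < k)%N by rewrite ltnS leq_addr.
pose i0 := Ordinal is_k.
have nthE y z (i : 'I_k) : i != i0 -> nth (true, 0) (w y) i = nth (true, 0) (w z) i.
  rewrite -val_eqE /= => ii; rewrite !nth_cat; case: ltnP => // si.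
  have : (0 < i - size s)%N by rewrite subn_gt0 ltn_neqAle eq_sym ii.
  by case: (i - size s)%N.
have nth0 y : nth (true, 0) (w y) i0 = (c, y) by rewrite nth_cat ltnn subnn.
have chiE y z : word_chi (w y) (n := k) = word_chi (w z) (n := k).
  apply: funext => i; rewrite /word_chi; have [->|ii] := eqVneq i i0.
    by rewrite !nth0.
  by rewrite (nthE y z).
rewrite mulrBr addrACA -opprD.
congr (_ - _).
  rewrite /w !big_cat !big_cons /= mulrDl mulrDr -scalerAl -scalerAr.
  exact: linearP.
(* Rewriting all three side maps to that of [w 0] makes the sums range over the same partitions. *)
rewrite /lower_terms (chiE (x *: a + b) 0) (chiE a 0) (chiE b 0) mulr_sumr -big_split /=.
apply: eq_bigr => P /andP[PB PT].
have [V0 V0P iV0] : exists2 V0, V0 \in P & i0 \in V0.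
  move: PB; rewrite inE => /andP[/and3P[/eqP cP _ _] _].
  have : i0 \in finset.cover P by rewrite cP inE.
  by case/bigcupP => V0 V0P iV0; exists V0.
have tP : finset.trivIset P by move: PB; rewrite inE => /andP[/and3P[]].
pose H y := \prod_(V in P | V != V0) block_val cum (interior (word_chi (w 0) (n := k))
  P V) (sub_word (w y) V).
have HE y : H y = H 0.
  apply: eq_bigr => V /andP[VP VV0]; congr block_val; apply/eq_in_map => i.
  rewrite mem_enum => iV; apply: nthE; apply: contraNneq VV0 => ii.
  have := trivIsetP tP V V0 VP V0P;
    case: eqP => // _ /(_ isT) /disjoint_setI0 /setP/(_ i0).
  by rewrite !inE iV0 -ii iV.
rewrite !(bigD1 V0 V0P) /= -!/(H _) (HE (_ + _)) (HE a) (HE b) mulrA -mulrDl.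
congr (_ * _).
have [t [t' tE]] : exists t t', forall y, sub_word (w y) V0 = t ++ (c, y) :: t'.
  have [e1 [e2 [eE]]] : exists e1 e2, enum V0 = e1 ++ i0 :: e2 /\ i0 \notin e1 ++ e2.
    have i0e : i0 \in enum V0 by rewrite mem_enum.
    have := enum_uniq V0; case/path.splitPr: i0e => e1 e2.
    rewrite uniq_catC /= mem_cat orbC -mem_cat => /andP[ie _].
    by exists e1, e2.
  rewrite mem_cat negb_or => /andP[n1 n2].
  exists [seq nth (true, 0) (w 0) i | i : 'I_k <- e1], [seq nth (true,
    0) (w 0) i | i : 'I_k <- e2] => y.
  rewrite /sub_word eE map_cat /= nth0; congr (_ ++ _ :: _); apply/eq_in_map => i ie.
    by apply: nthE; apply: contraNneq n1 => <-.
  by apply: nthE; apply: contraNneq n2 => <-.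
have lin K : multilinear K -> K (sub_word (w (x *: a + b)) V0) =
    x * K (sub_word (w a) V0) + K (sub_word (w b) V0).
  by move=> lK; rewrite !tE lK.
have cum_lin : cum (sub_word (w (x *: a + b)) V0) =
    x * cum (sub_word (w a) V0) + cum (sub_word (w b) V0).
  have := size_sub_word (w 0) V0; rewrite !tE size_cat /= addnS => st.
  by apply: IH; rewrite st (leq_trans (bnc_block_lt PB PT V0P)).
rewrite /block_val; case: interior => //; case: o o_lin => //= kappa; exact: lin.
Qed.

End CumulantExistence.

Section Cumulants.
Variables (F : fieldType) (A : ncps2 F).

Lemma prod_block_val n (chi : 'I_n -> bool) (kappa Kappa : seq (bool * A) -> F)
    (P : {set {set 'I_n}})
    (f : {set 'I_n} -> seq (bool * A)) :
  \prod_(V in P) block_val (Some kappa) Kappa (interior chi P V) (f V) =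
  (\prod_(V in P | interior chi P V) kappa (f V)) *
  (\prod_(V in P | ~~ interior chi P V) Kappa (f V)).
Proof.
rewrite (bigID (interior chi P)) /=; congr (_ * _).
  by apply: eq_bigr => V /andP[_ ->].
by apply: eq_bigr => V /andP[_ /negPf ->].
Qed.

Lemma cumulants_exist : exists kappa Kappa : seq (bool * A) -> F,
  lr_cumulants kappa /\ c_lr_cumulants kappa Kappa.
Proof.
pose kappa := cum (@npsi _ A) None.
have klin : multilinear kappa by exact: cum_multilinear.
exists kappa, (cum (@nphi _ A) (Some kappa)); split; split=> //.
- move=> n chi a n0; rewrite (cum_moment (@npsi _ A) None chi a n0).
  apply: eq_bigr => P _; apply: eq_bigr => V _.
  by rewrite /block_val; case: interior.
- exact: cum_multilinear.
move=> n chi a n0; rewrite (cum_moment (@nphi _ A) (Some kappa) chi a n0).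
by apply: eq_bigr => P _; rewrite prod_block_val.
Qed.

End Cumulants.

(** * The free algebra and functionals with given moments *)

Section FreeAlgebra.
Variables (T : choiceType) (F : fieldType).

Definition free_monoid := seq T.
HB.instance Definition _ := Choice.on free_monoid.

Lemma free_monoid_unit (x y : free_monoid) : x ++ y = [::] -> x = [::] /\ y = [::].
Proof. by case: x; case: y. Qed.

HB.instance Definition _ := Choice_isMonomialDef.Build free_monoid
  (@catA T) (@cat0s T) (@cats0 T) free_monoid_unit.

Lemma malg_scaleAr (c : F) (x y : {malg F[free_monoid]}) : c *: (x * y) = x * (c *: y).
Proof.
apply/malgP => k; rewrite mcoeffZ (mcoeffMlw k (fsubset_refl _) (msuppZ_le c y)) mcoeffMl.
rewrite mulr_sumr; apply: eq_bigr => i _; rewrite mulr_sumr; apply: eq_bigr => j _.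
by rewrite mcoeffZ mulrnAr mulrCA.
Qed.

Definition free_alg := {malg F[free_monoid]}.
HB.instance Definition _ := GRing.Lalgebra.on free_alg.
HB.instance Definition _ := GRing.Lalgebra_isAlgebra.Build F free_alg malg_scaleAr.

Definition gen (k : T) : free_alg := << ([:: k] : free_monoid) >>.

Lemma prod_gen (s : seq T) : \prod_(k <- s) gen k = << (s : free_monoid) >>.
Proof.
elim: s => [|k s IH]; first by rewrite big_nil.
rewrite big_cons IH; apply: etrans (fgmulUU _ _ _ _) _.
by rewrite mulr1.
Qed.

Variable g : seq T -> F.
(** Words form a basis of the free algebra, so every function [g] of words is the moment function of
    a linear functional. *)
Definition word_lift (x : free_alg) : F := free_lift (g : seq T -> F^o) x.

Lemma word_lift_scalar : scalar word_lift.
Proof. exact: (@free_lift_linear _ _ F^o). Qed.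

HB.instance Definition _ :=
  GRing.isLinear.Build F free_alg F *%R word_lift word_lift_scalar.

Lemma word_lift_prod (s : seq T) : word_lift (\prod_(k <- s) gen k) = g s.
Proof. by rewrite prod_gen /word_lift free_liftU. Qed.

End FreeAlgebra.

(** * Sums over bi-non-crossing partitions *)

Section WordSums.
Variables (T : Type) (F : fieldType) (side : T -> bool).
Implicit Types (s t : seq T) (u v : seq T -> F).

Definition side_at s (i : 'I_(size s)) := side (tnth (in_tuple s) i).
Definition letters_at s (V : {set 'I_(size s)}) := [seq tnth (in_tuple s) i | i <- enum
  V].

Definition bnc_sum u v s := \sum_(P in bnc (@side_at s)) \prod_(V in P)
  (if interior (@side_at s) P V then u (letters_at V) else v (letters_at V)).

Lemma size_letters_at s (V : {set 'I_(size s)}) : size (letters_at V) = #|V|.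
Proof. by rewrite size_map cardE. Qed.

Lemma letters_at_setT s : letters_at [set: 'I_(size s)] = s.
Proof. by rewrite /letters_at enum_setT -enumT map_tnth_enum. Qed.

Lemma bnc_sum_top u v s : (0 < size s)%N -> bnc_sum u v s = v s +
  \sum_(P in bnc (@side_at s) | P != [set [set: 'I_(size s)]]%SET) \prod_(V in P)
     (if interior (@side_at s) P V then u (letters_at V) else v (letters_at V)).
Proof.
move=> s0; rewrite /bnc_sum (bigD1 [set [set: 'I_(size s)]]%SET) /=; last exact: bnc_top.
by rewrite big_set1 interior_top letters_at_setT.
Qed.

(** The top partition contributes [v s], and the remaining terms involve shorter words only. This is
    the uniqueness of cumulants. *)
Lemma bnc_sum_inj u v u' v' s : (0 < size s)%N ->
  (forall t, (0 < size t < size s)%N -> u t = u' t /\ v t = v' t) ->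
  bnc_sum u v s = bnc_sum u' v' s -> v s = v' s.
Proof.
move=> s0 h; rewrite !bnc_sum_top // => e; move: e.
set S := (X in _ + X = _); set S' := (X in _ = _ + X).
have -> : S = S'; last by move=> /addIr.
apply: eq_bigr => P /andP[PB PT]; apply: eq_bigr => V VP.
have [|-> -> //] := h (letters_at V).
by rewrite size_letters_at (bnc_block_gt0 PB VP) (bnc_block_lt PB PT VP).
Qed.

Definition pair_val (C : T -> T -> F) s := if s is [:: k; p] then C k p else 0.

Lemma pair_val0 C s : size s != 2%N -> pair_val C s = 0.
Proof. by case: s => [|k [|p [|]]]. Qed.

(** Any other partition of two points has a block with fewer than two elements, where [pair_val]
    vanishes. *)
Lemma bnc_sum_pair C D k p : bnc_sum (pair_val D) (pair_val C) [:: k; p] = C k p.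
Proof.
rewrite bnc_sum_top // big1 ?addr0 // => P /andP[PB PT].
have : Ordinal (isT : (0 < 2)%N) \in finset.cover P.
  by move: PB; rewrite inE => /andP[/and3P[/eqP -> _ _] _]; rewrite inE.
case/bigcupP => V VP _; rewrite (bigD1 V VP) /= !pair_val0 ?if_same ?mul0r //.
all: by rewrite size_letters_at neq_ltn (bnc_block_lt PB PT VP).
Qed.

End WordSums.

(** * The Gaussian family *)

Section Gaussian.
Variables (F : fieldType) (I J : Type) (Cphi Cpsi : I + J -> I + J -> F).
(** Generators of the free algebra need a choice structure, which is taken classically since [I] and
    [J] are arbitrary types. *)
Let T := {classic (I + J)}.
Let side : T -> bool := @in_left I J.

(** The moments dictated by cumulants that are supported on pairs; the separate value at the empty
    word makes the functionals unital by computation. *)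
Definition gauss_moment (C D : T -> T -> F) (s : seq T) : F :=
  if nilp s then 1 else bnc_sum side (pair_val D) (pair_val C) s.

Lemma word_lift1 (g : seq T -> F) : g [::] = 1 -> word_lift g 1 = 1.
Proof. by move=> g1; have := word_lift_prod g [::]; rewrite big_nil g1. Qed.

Definition gauss_space : ncps2 F :=
  @Ncps2 F (free_alg T F) (word_lift (gauss_moment Cphi Cpsi))
   (word_lift (gauss_moment Cpsi Cpsi)) (word_lift1 erefl) (word_lift1 erefl).

Definition gauss_var (k : I + J) : gauss_space := gen F (k : T).

Lemma gauss_var_moment (s : seq (I + J)) : (0 < size s)%N ->
  nphi (\prod_(k <- s) gauss_var k) = bnc_sum (@in_left I J) (pair_val Cpsi) (pair_val
    Cphi) s /\
  npsi (\prod_(k <- s) gauss_var k) = bnc_sum (@in_left I J) (pair_val Cpsi) (pair_val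
    Cpsi) s.
Proof.
move=> s0; split; (apply: etrans (word_lift_prod _ (s : seq T)) _; rewrite /gauss_moment;
  by case: s s0).
Qed.

Lemma gauss_varP : centred_cbifree_gaussian gauss_var Cphi Cpsi.
Proof.
split=> [k p|].
  have := @gauss_var_moment [:: k; p] isT.
  by rewrite big_cons big_seq1 !bnc_sum_pair.
have [kappa [Kappa [kP KP]]] := cumulants_exist gauss_space.
exists kappa, Kappa; split=> // s s0 s2.
pose bw (s : seq (I + J)) := [seq (in_left k, gauss_var k) | k <- s].
(* The cumulants are known only through the moment formulas; as [pair_val] satisfies the same
   formulas, uniqueness identifies them by induction on the length. *)
suff h : kappa (bw s) = pair_val Cpsi s /\ Kappa (bw s) = pair_val Cphi s.
  by rewrite -/(bw s) h.1 h.2 !pair_val0.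
have [n] := ubnP (size s); elim: n s s0 {s2} => // n IH s s0; rewrite ltnS => sn.
have prodE : \prod_(i < size s) gauss_var (tnth (in_tuple s) i) = \prod_(k <- s)
  gauss_var k.
  by rewrite [RHS]big_tnth.
have restrE (V : {set 'I_(size s)}) : restr (@side_at _ (@in_left I J) s)
    (fun i => gauss_var (tnth (in_tuple s) i)) V = bw (letters_at V).
  by rewrite /bw /letters_at -map_comp.
have [mphi mpsi] := gauss_var_moment s0.
have lower t : (0 < size t < size s)%N ->
    kappa (bw t) = pair_val Cpsi t /\ Kappa (bw t) = pair_val Cphi t.
  by move=> /andP[t0 ts]; apply: IH; rewrite ?(leq_trans ts).
split.
  apply: (@bnc_sum_inj _ _ (@in_left I J) (kappa \o bw) (kappa \o bw) (pair_val Cpsi))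
    => //.
    by move=> t /lower[h _] /=; rewrite h.
  rewrite -mpsi -prodE (kP.2 _ (@side_at _ (@in_left I J) s)) //.
  apply: eq_bigr => P _; apply: eq_bigr => V _.
  by rewrite restrE /= if_same.
apply: (@bnc_sum_inj _ _ (@in_left I J) (kappa \o bw) (Kappa \o bw) (pair_val Cpsi)) =>
  //.
rewrite -mphi -prodE (KP.2 _ (@side_at _ (@in_left I J) s)) //.
apply: eq_bigr => P _; rewrite -prod_block_val; apply: eq_bigr => V _.
by rewrite restrE /block_val.
Qed.

End Gaussian.

(** * Mixed moments *)

(** On a nonempty reduced word both sides vanish, since its letters lie in the kernels of [vpsi]. So
    [vpsi] has the product form demanded of [Theta]. *)
Lemma vpsi_tens (F : fieldType) (X : nat -> tsvs F) (w : word X) : reduced w ->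
  @vpsi _ (cfree_product X) (tens w) = \prod_(y <- w) vpsi (tagged y).
Proof.
move=> rw; rewrite [LHS]cf_lift_tens //; last exact: cf_psi_multilin.
rewrite /cf_psi_word; case: w rw => [|y w]; first by rewrite big_nil.
by rewrite /reduced big_cons /= => /andP[/andP[/eqP -> _] _]; rewrite mul0r.
Qed.

Lemma vphi_tens (F : fieldType) (X : nat -> tsvs F) (w : word X) : reduced w ->
  @vphi _ (cfree_product X) (tens w) = \prod_(y <- w) vphi (tagged y).
Proof. by move=> rw; rewrite [LHS]cf_lift_tens //; apply: cf_phi_multilin. Qed.

Section MixedMoments.
Variables (F : numFieldType) (A : ncps2 F) (T : Type) (side : T -> bool).
Variables (a : nat -> T -> A) (X : nat -> tsvs F) (tau : forall n,
  T -> {linear X n -> X n}).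
Variables (theta : forall n, {scalar X n}) (Theta : {scalar (cfree_product X)}).
Variable mu : {scalar A}.
Hypothesis theta_xi : forall n, theta n (vxi _) = 1.
Hypothesis ThetaE : forall w, reduced w ->
  Theta (tens w) = \prod_(y <- w) theta (tag y) (tagged y).
Hypothesis muE : forall u : seq (nat * T),
  mu (\prod_(c <- u) a c.1 c.2) = Theta (act side tau u (tens [::])).
Hypothesis psiE : forall u : seq (nat * T),
  npsi (\prod_(c <- u) a c.1 c.2) = vpsi (act side tau u (tens [::]) : cfree_product X).
Hypothesis centred : forall n t, mu (a n t) = 0 /\ npsi (a n t) = 0.
Implicit Types (u : seq (nat * T)) (ts : seq T).

Lemma mu_local n ts : mu (\prod_(t <- ts) a n t) = theta n (locact tau ts (vxi (X n))).
Proof. by rewrite -(Theta_local side tau theta_xi ThetaE) -muE big_map. Qed.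

Lemma psi_local n ts : npsi (\prod_(t <- ts) a n t) = vpsi (locact tau ts (vxi (X n))).
Proof.
rewrite -(@Theta_local _ X T side tau (fun n => @vpsi _ (X n)) _ (fun n =>
  vpsi_xi (X n)) (@vpsi_tens _ X)).
by rewrite -psiE big_map.
Qed.

Lemma mu_single u1 n t u2 : n \notin map fst u1 -> n \notin map fst u2 ->
  mu (\prod_(c <- u1 ++ (n, t) :: u2) a c.1 c.2) = 0.
Proof.
move=> n1 n2; rewrite muE; have [m0 p0] := centred n t.
have mt := mu_local n [:: t]; have pt := psi_local n [:: t].
rewrite big_seq1 /= in mt; rewrite big_seq1 /= in pt.
by apply: (@act_single _ X T side tau theta); rewrite // -?mt -?pt.
Qed.

Hypothesis bounded : forall ts, exists M : F, forall n,
  `|npsi (\prod_(t <- ts) a n t)| <= M /\ `|mu (\prod_(t <- ts) a n t)| <= M.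

Lemma mu_bounded ts : exists M : F, forall u, map snd u = ts ->
  `|mu (\prod_(c <- u) a c.1 c.2)| <= M.
Proof.
have bd s : exists M : F, forall n, `|vpsi (locact tau s (vxi (X n)))| <= M /\
    `|theta n (locact tau s (vxi (X n)))| <= M.
  by have [M hM] := bounded s; exists M => n; rewrite -psi_local -mu_local.
have [M hM] := act_bounded side theta_xi ThetaE bd ts [::].
by exists M => u us; rewrite muE; apply: (hM u [::]).
Qed.

(** [act_pairs] is applied to the empty tensor: the word of labels is then [f] read in the
    chi-order, and the constants of a label are the moments of its fibre. *)
Lemma mu_pairs d N (f : 'I_d -> 'I_N) (k : 'I_d -> T) :
  (forall i, #|fiber f (f i)| = 2%N) ->
  mu (\prod_(i < d) a (f i) (k i)) =
  if kernel f \in bnc (fun i => side (k i)) then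
    \prod_(V in kernel f) (if interior (fun i => side (k i)) (kernel f) V
      then npsi (\prod_(i <- enum V) a (f i) (k i)) else mu (\prod_(i <- enum V) a (f
        i) (k i)))
  else 0.
Proof.
move=> f2; pose u := [seq (val (f i), k i) | i <- enum 'I_d].
have -> : \prod_(i < d) a (f i) (k i) = \prod_(c <- u) a c.1 c.2.
  by rewrite /u big_map enumT [index_enum _]unlock.
pose lt n := letters n u.
have ltE n : lt n = [seq k i | i <- enum 'I_d & val (f i) == n].
  by rewrite /lt /letters /u (filter_map (fun i : 'I_d => (val (f i), k i))) -map_comp.
pose cpsi n := npsi (\prod_(t <- lt n) a n t).
pose cmu n := mu (\prod_(t <- lt n) a n t).
have blockE (i : 'I_d) : \prod_(t <- lt (f i)) a (f i) t =
    \prod_(j <- enum (fiber f (f i))) a (f j) (k j).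
  rewrite ltE big_map enumT -(big_map id xpredT (fun j => a (f j) (k j))) map_id.
  have -> : enum (fiber f (f i)) = [seq j <- Finite.enum 'I_d | val (f j) == val (f i)].
    by apply: eq_filter => j; rewrite -[LHS]/(j \in fiber f (f i)) inE -val_eqE.
  by apply: eq_big_seq => j; rewrite mem_filter => /andP[/eqP <- _].
have chiE : chi_word side u ([::] : word X) = [seq val (f i) | i <- chi_enum (fun i =>
  side (k i))].
  by rewrite /chi_word /left_labels /right_labels /u /chi_enum
    !(filter_map (fun i : 'I_d => (val (f i), k i))) -!map_comp map_cat map_rev.
have cnt n : count_mem n (map fst u) = #|[set i | val (f i) == n]|.
  rewrite /u -map_comp count_map -sum1_count big_enum_cond -sum1_card /=.
  by apply: eq_bigl => i; rewrite !inE.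
have cntf (i : 'I_d) : count_mem (val (f i)) (map fst u) = 2%N.
  by rewrite cnt -(f2 i); apply: eq_card => j; rewrite !inE.
have tau0 n t : vpsi (tau n t (vxi _)) = 0 /\ theta n (tau n t (vxi _)) = 0.
  have [m0 p0] := centred n t.
  have mt := mu_local n [:: t]; have pt := psi_local n [:: t].
  by rewrite big_seq1 /= in mt; rewrite big_seq1 /= in pt; rewrite -mt -pt.
rewrite muE (@act_pairs _ X T side tau theta Theta theta_xi ThetaE _ _ N cpsi cmu) //.
- rewrite chiE (@weight_kernel _ _ _ _ f2 _ _ _ (fun V =>
  npsi (\prod_(i <- enum V) a (f i) (k i)))
    (fun V => mu (\prod_(i <- enum V) a (f i) (k i)))) //.
    by move=> i; rewrite /cpsi blockE.
  by move=> i; rewrite /cmu blockE.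
- by move=> n t; case: (tau0 n t).
- by move=> n t; case: (tau0 n t).
- by rewrite chiE all_map; apply/allP => i _ /=.
- move=> n /=; have [nu|/count_memPn ->//] := boolP (n \in map fst u).
  have [i ->] : exists i, n = val (f i).
    by move: nu; rewrite /u -map_comp => /mapP[i _ ->]; exists i.
  by rewrite cntf.
- by move=> n _; rewrite -psi_local -mu_local.
Qed.

End MixedMoments.

(** * The limit theorem *)

Section ComplexLimits.
(* Imported locally: they shadow [interior] and [filter]. *)
Import topology normedtype numFieldNormedType.Exports.
Variable R : realType.
Implicit Types (u v : nat -> R[i]) (l : R[i]).

Lemma cvg_complexP u l : cvg_complex u l <->
  forall e : R[i], 0 < e -> exists N, forall n, (N <= n)%N -> `|l - u n| < e.
Proof.
split=> [h e e0|h].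
  have /cvgrPdist_lt/(_ e e0)[N _ hN] := h; exists N => n Nn; exact: hN.
apply/cvgrPdist_lt => e e0; have [N hN] := h e e0.
by exists N => // n /= Nn; apply: hN.
Qed.

Lemma cvg_complexD u v l m : cvg_complex u l -> cvg_complex v m ->
  cvg_complex (fun n => u n + v n) (l + m).
Proof. exact: cvgD. Qed.

Lemma cvg_complexM u v l m : cvg_complex u l -> cvg_complex v m ->
  cvg_complex (fun n => u n * v n) (l * m).
Proof. exact: cvgM. Qed.

Lemma cvg_complex_cst l : cvg_complex (fun=> l) l.
Proof. exact: cvg_cst. Qed.

(** The index [0] is left out because the normalizing factors are inverses of [N] and of its root,
    which are meaningful for positive [N] only. *)
Lemma eq_cvg_complex u v l : (forall n, (0 < n)%N -> u n = v n) ->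
  cvg_complex u l -> cvg_complex v l.
Proof.
move=> uv /cvg_complexP h; apply/cvg_complexP => e /h[N hN]; exists N.+1 => n Nn.
by rewrite -uv ?hN ?(leq_trans _ Nn) // ltnW.
Qed.

Lemma cvg_complex_sum (I : Type) (r : seq I) (P : pred I) (u : I -> nat -> R[i])
    (l : I -> R[i]) :
  (forall i, P i -> cvg_complex (u i) (l i)) ->
  cvg_complex (fun n => \sum_(i <- r | P i) u i n) (\sum_(i <- r | P i) l i).
Proof.
move=> h; elim: r => [|i r IH].
  rewrite big_nil; apply: eq_cvg_complex _ (@cvg_complex_cst 0) => n _.
  by rewrite big_nil.
rewrite big_cons; case: ifP => Pi.
  apply: eq_cvg_complex _ (cvg_complexD (h i Pi) IH) => n _.
  by rewrite big_cons Pi.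
by apply: eq_cvg_complex _ IH => n _; rewrite big_cons Pi.
Qed.

Lemma cvg_complex_prod (I : Type) (r : seq I) (P : pred I) (u : I -> nat -> R[i])
    (l : I -> R[i]) :
  (forall i, P i -> cvg_complex (u i) (l i)) ->
  cvg_complex (fun n => \prod_(i <- r | P i) u i n) (\prod_(i <- r | P i) l i).
Proof.
move=> h; elim: r => [|i r IH].
  rewrite big_nil; apply: eq_cvg_complex _ (@cvg_complex_cst 1) => n _.
  by rewrite big_nil.
rewrite big_cons; case: ifP => Pi.
  apply: eq_cvg_complex _ (cvg_complexM (h i Pi) IH) => n _.
  by rewrite big_cons Pi.
by apply: eq_cvg_complex _ IH => n _; rewrite big_cons Pi.
Qed.

Lemma sqrtC_nat_ge1 n : (0 < n)%N -> 1 <= sqrtC (n%:R : R[i]).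
Proof. by move=> n0; rewrite -[leLHS]sqrtC1 ler_sqrtC ?nnegrE ?ler01 ?ler0n // ler1n. Qed.

Lemma cvg_complex_squeeze0 u (M : R[i]) :
  (forall n, (0 < n)%N -> `|u n| <= M * (sqrtC n%:R)^-1) -> cvg_complex u 0.
Proof.
move=> h; apply/cvg_complexP => e e0.
have M0 : 0 <= M.
  by apply: le_trans (normr_ge0 (u 1%N)) _; have := h 1%N isT; rewrite sqrtC1 invr1 mulr1.
(* Beyond the square of [M / e] the bound drops below [e]; that square is real, so the Archimedean
   property of [R] gives [N]. *)
have [N Nge] : exists N : nat, (M / e) ^+ 2 < N%:R.
  have [x xE] : exists x : R, (M / e) ^+ 2 = x%:C.
    have /complex_realP[x xE] : (M / e) ^+ 2 \is Num.real.
      by rewrite realX // realM ?realV // ger0_real // ltW.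
    by exists x.
  exists (Num.truncn x).+1; rewrite xE.
  have := truncnS_gt x; rewrite -ltcR rmorph_nat; exact.
exists N.+1 => n Nn; have n0 : (0 < n)%N by apply: leq_trans Nn.
rewrite sub0r normrN; apply: le_lt_trans (h n n0) _.
have s0 : 0 < sqrtC (n%:R : R[i]) by rewrite sqrtC_gt0 ltr0n.
rewrite ltr_pdivrMr // mulrC -ltr_pdivrMr //.
rewrite -(@ltr_pXn2r _ 2) ?nnegrE ?divr_ge0 ?(ltW e0) ?(ltW s0) // sqrtCK.
by apply: lt_le_trans Nge _; rewrite ler_nat ltnW.
Qed.

End ComplexLimits.

(** * Counting functions by their number of values *)

Section Counting.
Variables (d N : nat).
Implicit Types (f : {ffun 'I_d -> 'I_N}).

Lemma card_kernel f : #|kernel f| = #|f @: [set: 'I_d]|.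
Proof. by rewrite /kernel (card_in_imset (@fiber_inj _ _ f)). Qed.

Lemma sum_kernel f : (\sum_(V in kernel f) #|V|)%N = d.
Proof. by rewrite -(card_partition (kernel_partition f)) cardsT card_ord. Qed.

Lemma fibers2_card f : (forall i,
  #|fiber f (f i)| = 2%N) -> (#|f @: [set: 'I_d]|.*2)%N = d.
Proof.
move=> f2; rewrite -[RHS](sum_kernel f) -card_kernel -muln2 -sum_nat_const.
by apply: eq_bigr => V /kernelP[i ->]; rewrite f2.
Qed.

(** The excesses [#|V| - 2] over the blocks add up to [d] minus twice the number of values, which
    the second hypothesis makes [0]. *)
Lemma fibers_ge2 f : (forall i, 2 <= #|fiber f (f i)|)%N ->
  (d <= #|f @: [set: 'I_d]|.*2)%N -> forall i, #|fiber f (f i)| = 2%N.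
Proof.
move=> f2 dle i.
have : (\sum_(V in kernel f) (#|V| - 2) == 0)%N.
  rewrite sumnB; last by move=> V /kernelP[j ->].
  by rewrite sum_kernel sum_nat_const muln2 card_kernel subn_eq0.
rewrite sum_nat_eq0 => /forall_inP/(_ _ (fiber_kernel f i)).
by rewrite subn_eq0 => h; apply/eqP; rewrite eqn_leq h f2.
Qed.

(** A function with at most [m] values factors through ['I_m], and the two factors can be chosen in
    [m ^ d] and [N ^ m] ways. *)
Lemma card_small_image m : (0 < d)%N ->
  (#|[set f : {ffun 'I_d -> 'I_N} | (#|f @: [set: 'I_d]| <= m)%N]| <= m ^ d * N ^ m)%N.
Proof.
move=> d0; pose comp (p : {ffun 'I_d -> 'I_m} * {ffun 'I_m -> 'I_N}) :=
  [ffun i => p.2 (p.1 i)].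
apply: leq_trans (_ : (#|comp @: [set: _]| <= _)%N); last first.
  by apply: leq_trans (leq_imset_card _ _) _;
    rewrite cardsT card_prod !card_ffun !card_ord.
apply: subset_leq_card; apply/subsetP => f; rewrite inE => fm.
pose e := enum (f @: [set: 'I_d]).
have fe i : f i \in e by rewrite mem_enum imset_f.
have ie i : (index (f i) e < m)%N.
  by rewrite (leq_trans _ fm) // cardE index_mem.
apply/imsetP; exists ([ffun i => Ordinal (ie i)],
  [ffun j : 'I_m => nth (f (Ordinal d0)) e j]) => //.
by apply/ffunP => i; rewrite !ffunE /= nth_index.
Qed.

End Counting.

Section Negligible.
Variables (R : realType) (d : nat).
Hypothesis d_gt0 : (0 < d)%N.

(** The largest [m] with [2m < d] leaves at most [m ^ d * N ^ m] functions, and the normalization is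
    the power [-d/2] of [N]; since [d] is at least [2m + 1], the product is at most of order one
    over the root of [N]. *)
Lemma negligible (h : forall N, {ffun 'I_d -> 'I_N} -> R[i]) (M : R[i]) :
  (forall N f, `|h N f| <= M) ->
  cvg_complex (fun N => (sqrtC N%:R)^-1 ^+ d *
    \sum_(f : {ffun 'I_d -> 'I_N} | (#|f @: [set: 'I_d]|.*2 < d)%N) h N f) 0.
Proof.
move=> hM; pose m := d.-1./2.
have [e dE] : exists e, d = (m.*2 + e).+1.
  exists (d.-1 - m.*2)%N; rewrite subnKC ?prednK // -geq_half_double //.
have M0 : 0 <= M.
  exact: le_trans (normr_ge0 _) (hM 1%N [ffun=> ord0]).
apply: (@cvg_complex_squeeze0 _ _ (M * (m ^ d)%:R)) => N N0.
set x := sqrtC _; have x1 : 1 <= x by exact: sqrtC_nat_ge1.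
have x0 : 0 < x by apply: lt_le_trans x1.
have xV0 : 0 <= x^-1 by rewrite invr_ge0 ltW.
rewrite normrM (ger0_norm (exprn_ge0 _ xV0)).
have hS : `|\sum_(f : {ffun 'I_d -> 'I_N} | (#|f @: [set: 'I_d]|.*2 < d)%N) h N f|
    <= M * (m ^ d * N ^ m)%:R.
  apply: le_trans (ler_norm_sum _ _ _) _.
  apply: le_trans (ler_sum _ (fun f _ => hM N f)) _.
  rewrite big_const iter_addr_0 -[M *+ _]mulr_natr ler_wpM2l // ler_nat.
  apply: leq_trans (card_small_image N m d_gt0); apply: subset_leq_card.
  apply/subsetP => f; rewrite !inE => hf; rewrite /m geq_half_double.
  by rewrite -ltnS prednK.
apply: le_trans (ler_wpM2l (exprn_ge0 _ xV0) hS) _.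
rewrite natrM mulrA mulrCA mulrA -mulrA ler_wpM2l ?mulr_ge0 ?ler0n //.
rewrite natrX -(sqrtCK N%:R) -/x -exprM mul2n dE exprS exprD.
have -> : x^-1 * (x^-1 ^+ m.*2 * x^-1 ^+ e) * x ^+ m.*2 = x^-1 * x^-1 ^+ e * (x^-1 * x)
  ^+ m.*2.
  by rewrite exprMn -!mulrA; congr (_ * _); rewrite mulrCA.
rewrite mulVf ?gt_eqF // expr1n mulr1 ler_piMr // exprn_ile1 //.
by rewrite invf_le1.
Qed.

End Negligible.

(** * Sums over functions constant on blocks *)

Section Factorization.
Variables (C : comNzRingType) (d N : nat) (P : {set {set 'I_d}}).
Hypothesis Ppart : finset.partition P [set: 'I_d].

Definition constant_on (f : {ffun 'I_d -> 'I_N}) :=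
  [forall V in P, forall i in V, forall j in V, f i == f j].

Lemma constant_onP (f : {ffun 'I_d -> 'I_N}) : reflect (forall V i j,
  V \in P -> i \in V -> j \in V -> f i = f j)
  (constant_on f).
Proof.
apply: (iffP forall_inP) => [h V i j VP iV jV|h V VP].
  by apply/eqP; apply: (forall_inP (forall_inP (h V VP) i iV)).
by apply/forall_inP => i iV; apply/forall_inP => j jV; apply/eqP; apply: h VP iV jV.
Qed.

(** A function constant on the blocks is the same as a function on the set of blocks, via the block
    [blk i] of a point and a representative [rep j] of a block; the sum then factors by
    distributivity. *)
Lemma sum_constant_on (c : {set 'I_d} -> ('I_d -> 'I_N) -> C) :
  (forall V f g, V \in P -> {in V, f =1 g} -> c V f = c V g) ->
  \sum_(f : {ffun 'I_d -> 'I_N} | constant_on f) \prod_(V in P) c V f =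
  \prod_(V in P) \sum_(n < N) c V (fun=> n).
Proof.
move=> cE; have /and3P[/eqP cP tP P0] := Ppart.
have [blk blkP] : exists blk : 'I_d -> 'I_#|P|, forall i, i \in enum_val (blk i).
  apply: (@fin_all_exists _ (fun=> 'I_#|P|) (fun i j => i \in enum_val j)) => i.
  have : i \in finset.cover P by rewrite cP inE.
  by case/bigcupP => V VP iV; exists (enum_rank_in VP V); rewrite enum_rankK_in.
have [rep repP] : exists rep : 'I_#|P| -> 'I_d, forall j, rep j \in enum_val j.
  have : forall j : 'I_#|P|, exists i, i \in enum_val j;
    last by case/fin_all_exists => r; exists r.
  move=> j; apply/set0Pn; apply: contraNneq P0 => <-; exact: enum_valP.
have blkE (i : 'I_d) (j : 'I_#|P|) : i \in enum_val j -> blk i = j.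
  move=> ij; apply: enum_val_inj; apply/eqP; apply: contraT => ne.
  have := trivIsetP tP _ _ (enum_valP (blk i)) (enum_valP j) ne.
  by move=> /disjoint_setI0/setP/(_ i); rewrite !inE blkP ij.
rewrite [RHS]big_enum_val bigA_distr_bigA /=.
rewrite (reindex_onto (fun h : {ffun 'I_#|P| -> 'I_N} => [ffun i => h (blk i)])
   (fun f => [ffun j => f (rep j)])) /=; last first.
  move=> f /constant_onP cf; apply/ffunP => i; rewrite !ffunE.
  exact: cf (enum_valP (blk i)) (repP _) (blkP i).
apply: eq_big => h.
  apply/andP; split.
    apply/constant_onP => V i j VP; have := enum_rankK_in VP VP => /= <- iV jV.
    by rewrite !ffunE (blkE _ _ iV) (blkE _ _ jV).
  by apply/eqP/ffunP => j; rewrite !ffunE (blkE _ _ (repP j)).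
move=> _; rewrite big_enum_val; apply: eq_bigr => j _; apply: cE; first exact: enum_valP.
by move=> i ij; rewrite ffunE (blkE _ _ ij).
Qed.

End Factorization.

(** * The central limit theorem for one functional *)

Section FunctionalCLT.
Variables (R : realType) (A : ncps2 R[i]) (T : Type) (side : T -> bool) (a : nat -> T
  -> A).
Variables (psi mu : {scalar A}) (Cpsi Cmu : T -> T -> R[i]).
Implicit Types (u : seq (nat * T)).
Hypothesis single : forall u1 n t u2, n \notin map fst u1 -> n \notin map fst u2 ->
  mu (\prod_(c <- u1 ++ (n, t) :: u2) a c.1 c.2) = 0.
Hypothesis psi_bounded : forall ts, exists M : R[i], forall u, map snd u = ts ->
  `|psi (\prod_(c <- u) a c.1 c.2)| <= M.
Hypothesis mu_bounded : forall ts, exists M : R[i], forall u, map snd u = ts ->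
  `|mu (\prod_(c <- u) a c.1 c.2)| <= M.
Hypothesis pairs : forall d N (f : 'I_d -> 'I_N) (k : 'I_d -> T),
  (forall i, #|fiber f (f i)| = 2%N) ->
  mu (\prod_(i < d) a (f i) (k i)) =
  if kernel f \in bnc (fun i => side (k i)) then
    \prod_(V in kernel f) (if interior (fun i => side (k i)) (kernel f) V
      then psi (\prod_(i <- enum V) a (f i) (k i)) else mu (\prod_(i <- enum V) a (f i)
        (k i)))
  else 0.
Hypothesis psi_cov : forall k p,
  cvg_complex (fun N => N%:R^-1 * \sum_(n < N) psi (a n k * a n p)) (Cpsi k p).
Hypothesis mu_cov : forall k p,
  cvg_complex (fun N => N%:R^-1 * \sum_(n < N) mu (a n k * a n p)) (Cmu k p).

Section Word.
Variables (s : seq T).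
Hypothesis s_gt0 : (0 < size s)%N.
Let d := size s.
Let k (i : 'I_d) := tnth (in_tuple s) i.
Let chi (i : 'I_d) := side (k i).
Let v N (f : {ffun 'I_d -> 'I_N}) := mu (\prod_(i < d) a (f i) (k i)).
Let x N : R[i] := (sqrtC N%:R)^-1.
Let small N (f : {ffun 'I_d -> 'I_N}) := (#|f @: [set: 'I_d]|.*2 < d)%N.
Let paired N (f : {ffun 'I_d -> 'I_N}) := [forall i, #|fiber f (f i)| == 2%N].

Let word_of N (f : 'I_d -> 'I_N) (r : seq 'I_d) : seq (nat * T) := [seq (val (f i),
  k i) | i <- r].

Lemma prod_word_of N (f : 'I_d -> 'I_N) r :
  \prod_(c <- word_of f r) a c.1 c.2 = \prod_(i <- r) a (f i) (k i).
Proof. by rewrite big_map. Qed.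

Lemma prod_word_enum N (f : 'I_d -> 'I_N) :
  \prod_(i < d) a (f i) (k i) = \prod_(c <- word_of f (enum 'I_d)) a c.1 c.2.
Proof. by rewrite prod_word_of enumT [index_enum _]unlock. Qed.

(** If all fibres had at least two elements, having [d/2] values or more would make them all pairs.
    So some fibre is a single position, whose label occurs once. *)
Lemma unpaired_moment0 N (f : {ffun 'I_d -> 'I_N}) : ~~ small f -> ~~ paired f -> v f = 0.
Proof.
rewrite /small -leqNgt => nsm np.
have [i f1] : exists i, (#|fiber f (f i)| < 2)%N.
  apply/existsP; apply: contraR np => h; apply/forallP => i; apply/eqP.
  apply: fibers_ge2 => // j; rewrite leqNgt; apply: contra h => h.
  by apply/existsP; exists j.
rewrite ltnS in f1; have fi (j : 'I_d) : f j = f i -> j = i.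
  move=> ji; apply: (card_le1_eqP f1); rewrite inE ?ji ?eqxx //.
rewrite /v prod_word_enum; have ie : i \in enum 'I_d by rewrite mem_enum.
have := enum_uniq 'I_d; case/path.splitPr: ie => e1 e2.
rewrite uniq_catC /= mem_cat negb_or => /andP[/andP[n2 n1] _].
rewrite /word_of map_cat /= single //.
  apply: contra n1; rewrite -map_comp => /mapP[j je /= ji].
  by rewrite -(fi j) //; apply: val_inj.
apply: contra n2; rewrite -map_comp => /mapP[j je /= ji].
by rewrite -(fi j) //; apply: val_inj.
Qed.

Lemma moment_expansion N :
  mu (\prod_(t <- s) (x N *: \sum_(n < N) a n t)) =
  x N ^+ d * \sum_(f : {ffun 'I_d -> 'I_N} | small f) v f +
  \sum_(P in bnc chi) x N ^+ d *
     \sum_(f : {ffun 'I_d -> 'I_N} | (paired f && (kernel f \in bnc chi)) && (kernel f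
       == P)) v f.
Proof.
rewrite big_tnth scaler_prod prodr_const card_ord bigA_distr_bigA linearZ /= linear_sum
  /=.
rewrite (bigID (@small N)) /= mulrDr; congr (_ + _).
rewrite -mulr_sumr; congr (_ * _).
transitivity (\sum_(f : {ffun 'I_d -> 'I_N} | paired f) v f).
  rewrite (bigID (@paired N)) /= [X in _ + X]big1 ?addr0; last first.
    by move=> f /andP[]; apply: unpaired_moment0.
  apply: eq_bigl => f; rewrite andbC; case pf: (paired f) => //=.
  by rewrite /small (fibers2_card (fun i => eqP (forallP pf i))) ltnn.
rewrite (bigID (fun f : {ffun 'I_d -> 'I_N} =>
  kernel f \in bnc chi)) /= [X in _ + X]big1 ?addr0.
  by rewrite (partition_big (fun f : {ffun 'I_d -> 'I_N} =>
    kernel f) (mem (bnc chi))) // => f /andP[].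
move=> f /andP[/forallP pf /negPf nb]; rewrite /v pairs; first by rewrite -/chi nb.
by move=> i; apply/eqP.
Qed.

Let c (P : {set {set 'I_d}}) (V : {set 'I_d}) N (f : 'I_d -> 'I_N) : R[i] :=
  if interior chi P V then psi (\prod_(i <- enum V) a (f i) (k i))
  else mu (\prod_(i <- enum V) a (f i) (k i)).

Lemma block_bound P V : exists M : R[i], forall N (f : 'I_d -> 'I_N), `|c P V f| <= M.
Proof.
have [M hM] := psi_bounded [seq k i | i <- enum V].
have [M' hM'] := mu_bounded [seq k i | i <- enum V].
rewrite /c; case: interior; [exists M|exists M'] => N f; rewrite -prod_word_of;
  [apply: hM|apply: hM']; by rewrite /word_of -map_comp.
Qed.

Lemma block_cvg (P : {set {set 'I_d}}) (V : {set 'I_d}) : #|V| = 2%N ->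
  cvg_complex (fun N => N%:R^-1 * \sum_(n < N) c P V (fun=> n))
   (if interior chi P V then pair_val Cpsi [seq k i | i <- enum V]
    else pair_val Cmu [seq k i | i <- enum V]).
Proof.
rewrite cardE /c => V2; case: (enum V) V2 => [|i [|j []]] //= _.
case: interior; [have h := @psi_cov (k i) (k j)|have h := @mu_cov (k i) (k j)];
apply: eq_cvg_complex _ h => N _; congr (_ * _); apply: eq_bigr => n _;
by rewrite big_cons big_seq1.
Qed.

(** Constancy on the pairs of [P] gives fibres with at least two elements; enough values then force
    exactly two, so that each fibre is a block of [P]. *)
Lemma constant_small_kernel N (f : {ffun 'I_d -> 'I_N}) P : P \in bnc chi ->
  (forall V, V \in P -> #|V| = 2%N) ->
  (constant_on P f && ~~ small f) =
  (paired f && (kernel f \in bnc chi)) && (kernel f == P).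
Proof.
move=> PB P2; have := PB; rewrite inE => /andP[PP _].
have /and3P[/eqP cP tP P0] := PP.
apply/idP/idP.
  move=> /andP[/constant_onP fP]; rewrite /small -leqNgt => nsm.
  have blk i : exists2 V, V \in P & i \in V.
    have : i \in finset.cover P by rewrite cP inE.
    by case/bigcupP => V VP iV; exists V.
  have sub V i : V \in P -> i \in V -> V \subset fiber f (f i).
    by move=> VP iV; apply/subsetP => j jV; rewrite inE (fP V j i).
  have f2 : forall i, #|fiber f (f i)| = 2%N.
    apply: fibers_ge2 => // i; have [V VP iV] := blk i.
    by rewrite -(P2 V VP) subset_leq_card // sub.
  have fE V i : V \in P -> i \in V -> V = fiber f (f i).
    by move=> VP iV; apply/eqP; rewrite eqEcard sub // f2 P2.
  have kP : kernel f = P.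
    apply/setP => V; apply/idP/idP => [/kernelP[i ->]|VP].
      by have [W WP iW] := blk i; rewrite -(fE W i).
    have /set0Pn[i iV] : V != set0 by apply: contraNneq P0 => <-.
    by rewrite (fE V i) // fiber_kernel.
  by rewrite kP PB eqxx !andbT; apply/forallP => i; rewrite f2.
move=> /andP[/andP[/forallP pf _] /eqP kP]; apply/andP; split.
  by apply/constant_onP => V i j; rewrite -kP; apply: kernel_constant.
by rewrite /small (fibers2_card (fun i => eqP (pf i))) ltnn.
Qed.

Lemma paired_moment N (f : {ffun 'I_d -> 'I_N}) P :
  (paired f && (kernel f \in bnc chi)) && (kernel f == P) -> v f = \prod_(V in P) c P V f.
Proof.
case/andP => /andP[/forallP pf kb] /eqP <-; rewrite /v pairs.
  by rewrite -/chi kb.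
by move=> i; apply/eqP.
Qed.

(** For a pairing [P], the product over the blocks of the Cesaro means of covariances is the
    normalized sum over all [f] constant on the blocks, and it has the desired limit. It differs
    from the sum over kernel [P] by functions with few values. *)
Lemma partition_cvg P : P \in bnc chi ->
  cvg_complex (fun N => x N ^+ d * \sum_(f : {ffun 'I_d -> 'I_N} |
       (paired f && (kernel f \in bnc chi)) && (kernel f == P)) v f)
    (\prod_(V in P) (if interior chi P V then pair_val Cpsi [seq k i | i <- enum V]
       else pair_val Cmu [seq k i | i <- enum V])).
Proof.
move=> PB; have [/forall_inP P2|] := boolP [forall V in P, #|V| == 2%N]; last first.
  (* A partition with a block not of size two yields [0] on both sides: [pair_val] vanishes on that
     block, and no [f] with fibres of size two has this kernel. *)
  rewrite negb_forall_in => /exists_inP[V VP V2].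
  rewrite (bigD1 V VP) /= !pair_val0 ?size_map -?cardE // if_same mul0r.
  apply: eq_cvg_complex _ (@cvg_complex_cst _ 0) => N _; rewrite big1 ?mulr0 //.
  move=> f /andP[/andP[/forallP pf _] /eqP kP]; move: VP V2; rewrite -kP.
  by case/kernelP => i ->; rewrite pf.
have {}P2 V : V \in P -> #|V| = 2%N by move=> VP; apply/eqP/P2.
have PP : finset.partition P [set: 'I_d] by move: PB; rewrite inE => /andP[].
have [M hM] : exists M : {set 'I_d} -> R[i], forall V N (f : 'I_d -> 'I_N),
  `|c P V f| <= M V.
  have := fun V => block_bound P V; exact: fin_all_exists.
pose h N (f : {ffun 'I_d -> 'I_N}) := if constant_on P f then \prod_(V in P) c P V f
  else 0.
have M0 V : 0 <= M V.
  exact: le_trans (normr_ge0 _) (hM V 1%N (fun=> ord0)).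
have hneg : cvg_complex (fun N => x N ^+ d *
    \sum_(f : {ffun 'I_d -> 'I_N} | (#|f @: [set: 'I_d]|.*2 < d)%N) h N f) 0.
  apply: (@negligible _ _ s_gt0 h (\prod_(V in P) M V)) => N f; rewrite /h.
  case: ifP => _; last by rewrite normr0 prodr_ge0.
  by rewrite normr_prod ler_prod // => V _; rewrite normr_ge0 hM.
have dE : d = (#|P|.*2)%N.
  rewrite -[LHS](card_ord d) -cardsT (card_partition PP) -muln2 -sum_nat_const.
  exact: eq_bigr.
(* The product of the block limits minus the negligible part; the factor [-1] expresses the
   subtraction. *)
have := cvg_complexD (@cvg_complex_prod R _ (index_enum _) (mem P) _ _
    (fun V VP => @block_cvg P V (P2 V VP))) (cvg_complexM (@cvg_complex_cst R (-1)) hneg).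
rewrite mulr0 addr0; apply: eq_cvg_complex => N N0.
have -> : \prod_(V in P) (N%:R^-1 * \sum_(n < N) c P V (fun=> n)) =
   x N ^+ d * \sum_(f : {ffun 'I_d -> 'I_N} | constant_on P f) \prod_(V in P) c P V f.
  rewrite (@sum_constant_on _ d N P PP (fun V f => c P V f)).
    rewrite big_split prodr_const /=; congr (_ * _).
    transitivity (x N ^+ #|P|.*2); last by congr (_ ^+ _).
    by rewrite -mul2n exprM; congr (_ ^+ _); rewrite /x exprVn sqrtCK.
  move=> V f g VP fg; rewrite /c;
    have -> : \prod_(i <- enum V) a (f i) (k i) = \prod_(i <- enum V) a (g i) (k i).
    by apply: eq_big_seq => i; rewrite mem_enum => iV; rewrite fg.
  by [].
rewrite mulN1r -mulrBr; congr (_ * _).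
rewrite (bigID (@small N)) /= [X in _ - X](_ : _ = \sum_(f : {ffun 'I_d -> 'I_N} |
  constant_on P f && small f) \prod_(V in P) c P V f).
  rewrite addrAC subrr add0r; apply: eq_big => f; first exact: constant_small_kernel.
  by rewrite constant_small_kernel // => /paired_moment.
rewrite big_mkcond [RHS]big_mkcond; apply: eq_bigr => f _.
by rewrite /h -/(small f) andbC; case: (small f).
Qed.

Lemma word_cvg : cvg_complex
  (fun N => mu (\prod_(t <- s) (x N *: \sum_(n < N) a n t)))
  (bnc_sum side (pair_val Cpsi) (pair_val Cmu) s).
Proof.
have [M hM] := mu_bounded [seq k i | i <- enum 'I_d].
have neg : cvg_complex (fun N => x N ^+ d * \sum_(f : {ffun 'I_d -> 'I_N} |
    (#|f @: [set: 'I_d]|.*2 < d)%N) v f) 0.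
  apply: (@negligible _ _ s_gt0 (fun N f => @v N f) M) => N f; rewrite /v prod_word_enum.
  by apply: hM; rewrite /word_of -map_comp.
have := cvg_complexD neg (@cvg_complex_sum R _ (index_enum _) (mem (bnc chi)) _ _ (fun
  P PB => @partition_cvg P PB)).
rewrite add0r; apply: eq_cvg_complex => N _; by rewrite moment_expansion.
Qed.

End Word.
End FunctionalCLT.

Lemma cbifree_families_realization (F : fieldType) (A : ncps2 F) (I J : Type)
    (a : nat -> I + J -> A) : cbifree_families a ->
  exists (X : nat -> tsvs F) (tau : forall n, I + J -> {linear X n -> X n}),
  forall u : seq (nat * (I + J)),
    nphi (\prod_(c <- u) a c.1 c.2) =
      vphi (act (@in_left I J) tau u (tens [::]) : cfree_product X) /\
    npsi (\prod_(c <- u) a c.1 c.2) =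
      vpsi (act (@in_left I J) tau u (tens [::]) : cfree_product X).
Proof.
case=> X [l [r [_ _ h]]].
exists X, (fun n t => if in_left t then l n (a n t) else r n (a n t)) => u.
have /= := h [seq (c.1, in_left c.2, a c.1 c.2) | c <- u].
rewrite big_map /=; set v := foldr _ _ _; set w := act _ _ _ _.
have -> : v = w.
  rewrite /v /w; elim: u {v w} => //= -[n t] u ->.
  by rewrite /op /=; case: t.
(* The letters are generators, hence elements of the generated left or right subalgebras. *)
apply=> t; elim: u {v w} => //= -[n k] u IH; rewrite inE => /orP[/eqP ->|/IH] //=.
by case: k => i /= S [_]; apply; exists i.
Qed.

(* The sequence of families is indexed from 0: [a n] is the (n+1)-st family. *)
Theorem theorem6p2 (R : realType) (I J : Type) (A : ncps2 R[i])
    (a : nat -> I + J -> A) (Cphi Cpsi : I + J -> I + J -> R[i])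
    (a_free : cbifree_families a)
    (a_centred : forall n k, nphi (a n k) = 0 /\ npsi (a n k) = 0)
    (a_bounded : forall s : seq (I + J), (0 < size s)%N ->
       bounded_seq (fun n => nphi (\prod_(k <- s) a n k)) /\
       bounded_seq (fun n => npsi (\prod_(k <- s) a n k)))
    (a_cov : forall k p,
       cvg_complex (fun N => N%:R^-1 * \sum_(n < N) nphi (a n k * a n p)) (Cphi k p) /\
       cvg_complex (fun N => N%:R^-1 * \sum_(n < N) npsi (a n k * a n p)) (Cpsi k p)) :
  exists (B : ncps2 R[i]) (b : I + J -> B),
    centred_cbifree_gaussian b Cphi Cpsi /\
    cvg_distribution
      (fun N k => (sqrtC (N%:R : R[i]))^-1 *: \sum_(n < N) a n k) b.
Proof.
exists (gauss_space Cphi Cpsi), (@gauss_var _ I J Cphi Cpsi); split;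
  first exact: gauss_varP.
have [X [tau real]] := cbifree_families_realization a_free.
have bounded ts : exists M : R[i], forall n,
    `|npsi (\prod_(t <- ts) a n t)| <= M /\ `|nphi (\prod_(t <- ts) a n t)| <= M.
  case: ts => [|t ts].
    by exists 1 => n; rewrite !big_nil nphi1 npsi1 normr1.
  have [[M hM] [M' hM']] := a_bounded (t :: ts) isT; exists (Num.max M M')%:C => n.
  have le1 : M'%:C <= (Num.max M M')%:C by rewrite lecR le_max lexx orbT.
  have le2 : M%:C <= (Num.max M M')%:C by rewrite lecR le_max lexx.
  by rewrite (le_trans (hM' n) le1) (le_trans (hM n) le2).
have phiE u := (real u).1; have psiE u := (real u).2.
have psi0 n t : npsi (a n t) = 0 /\ npsi (a n t) = 0 by case: (a_centred n t).
have bounded' ts : exists M : R[i], forall n,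
    `|npsi (\prod_(t <- ts) a n t)| <= M /\ `|npsi (\prod_(t <- ts) a n t)| <= M.
  by have [M hM] := bounded ts; exists M => n; case: (hM n).
have phi_xi n : vphi (vxi (X n)) = 1 := vphi_xi (X n).
have psi_xi n : vpsi (vxi (X n)) = 1 := vpsi_xi (X n).
have psi_bd := mu_bounded psi_xi (@vpsi_tens _ X) psiE psiE bounded'.
have phi_bd := mu_bounded phi_xi (@vphi_tens _ X) phiE psiE bounded.
move=> s s0; have [-> ->] := gauss_var_moment Cphi Cpsi s0; split.
- apply: (word_cvg (psi := @npsi _ A) (mu := @nphi _ A)) => //.
  + exact: mu_single phi_xi (@vphi_tens _ X) phiE psiE a_centred.
  + exact: mu_pairs phi_xi (@vphi_tens _ X) phiE psiE a_centred.
  + by move=> k p; case: (a_cov k p).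
  + by move=> k p; case: (a_cov k p).
(* For the second state, [npsi] weighs interior and exterior blocks alike. *)
apply: (word_cvg (psi := @npsi _ A) (mu := @npsi _ A)) => //.
- exact: (mu_single psi_xi (@vpsi_tens _ X) psiE psiE psi0).
- exact: (mu_pairs psi_xi (@vpsi_tens _ X) psiE psiE psi0).
- by move=> k p; case: (a_cov k p).
- by move=> k p; case: (a_cov k p).
Qed.
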